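(* Let $n\ge 2$. For $a\in\,]0,\pi]$ put $$\sigma_H(a)=\inf_{H}\Big\{\sup_{x\in\mathbb{R}^{2n-2}}\mu\big(p(\phi_H(B^{2n}(a))\cap D_x)\big)+\|H\|\Big\},$$ $$\hat\sigma_H(a)=\inf_{H}\Big\{\sup_{x\in\mathbb{R}^{2n-2}}\hat\mu\big(p(\phi_H(B^{2n}(a))\cap D_x)\big)+\|H\|\Big\},$$ where $H$ varies over $\mathcal{H}_c(2n)$. Then: (i) $\sigma_H(a)=0$ for all $a\in\,]0,\pi]$. (ii) $\hat\sigma_H(a)=0$ for all $a\in\,]0,\pi[$.
   Context: $\mathbb{R}^{2n}$ has coordinates $(x_1,y_1,\dots,x_n,y_n)$ and carries the standard symplectic form $\omega_0=\sum_{i=1}^n dx_i\wedge dy_i$. $B^{2n}(\pi r^2)$ denotes the closed $2n$-dimensional ball of radius $r$ centred at the origin (so $B^{2n}(a)$ has radius $\sqrt{a/\pi}$), $Z^{2n}(\pi)=B^2(\pi)\times\mathbb{R}^{2n-2}$ is the closed symplectic cylinder, $p\colon Z^{2n}(\pi)\to B^2(\pi)$ is the projection to the first factor, and $D_x=B^2(\pi)\times\{x\}$ for $x\in\mathbb{R}^{2n-2}$. $\mathcal{H}_c(2n)$ is the set of smooth functions $H\colon\mathbb{R}^{2n}\to\mathbb{R}$ whose support is a compact subset of $Z^{2n}(\pi)$. The (time-independent) Hamiltonian vector field $X_H$ is defined by $\omega_0(X_H(z),\cdot)=dH(z)$, $\phi_H$ is the time-1-map of the flow generated by $X_H$, and $\|H\|=\sup_{z\in\mathbb{R}^{2n}}H(z)-\inf_{z\in\mathbb{R}^{2n}}H(z)$.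 $\mu$ is Lebesgue measure on $\mathbb{R}^2$. For $T\subset\mathbb{R}^2$ the simply connected hull $\widehat T$ is the union of the closure $\overline T$ and the bounded components of $\mathbb{R}^2\setminus\overline T$, and $\hat\mu(T)=\mu(\widehat T)$. *)

(* Defs.v *)
From HB Require Import structures.
From mathcomp Require Import all_boot all_order all_algebra.
From mathcomp Require Import all_classical all_reals all_analysis.
Set Implicit Arguments.
Unset Strict Implicit.
Unset Printing Implicit Defensive.
Import Order.TTheory GRing.Theory Num.Theory.
Import numFieldNormedType.Exports.
Local Open Scope classical_set_scope.
Local Open Scope ring_scope.

(* R^{2n} is ['M[R]_(n, 2)]: row [i] of [z] is the pair (x_i, y_i), that is
   x_i = z i 0 and y_i = z i 1. The library norm on matrices is the sup norm,
   which induces the usual topology and derivatives; Euclidean balls are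
   defined below through [eucl_norm]. *)

Section Hamiltonian.
Context {R : realType}.

Definition eucl_norm {n} (z : 'M[R]_(n, 2)) : R :=
  Num.sqrt (\sum_i \sum_j z i j ^+ 2).

(* indexed by capacity: the radius is sqrt (a / pi) *)
Definition cball n (a : R) : set 'M[R]_(n, 2) :=
  [set z | eucl_norm z <= Num.sqrt (a / pi)].

Definition omega0 {n} (u v : 'M[R]_(n, 2)) : R :=
  \sum_i (u i 0 * v i 1 - u i 1 * v i 0).

Fixpoint Ck {n} (k : nat) (f : 'M[R]_(n, 2) -> R) : Prop :=
  match k with
  | 0%N => continuous f
  | k'.+1 => (forall z, differentiable f z) /\
             (forall v, Ck k' (fun z => 'D_v f z))
  end.

Definition smooth {n} (f : 'M[R]_(n, 2) -> R) : Prop := forall k, Ck k f.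

Definition supp {n} (f : 'M[R]_(n, 2) -> R) : set 'M[R]_(n, 2) :=
  closure [set z | f z != 0].

Definition cylinder m : set 'M[R]_(m.+1, 2) :=
  [set z | cball pi (row ord0 z)].

Definition proj1 {m} (z : 'M[R]_(m.+1, 2)) : R * R := (z ord0 0, z ord0 1).

Definition disc {m} (x : 'M[R]_(m, 2)) : set 'M[R]_(m.+1, 2) :=
  [set z | cball pi (row ord0 z) /\ row' ord0 z = x].

Definition Hc {m} (H : 'M[R]_(m.+1, 2) -> R) : Prop :=
  [/\ smooth H, compact (supp H) & supp H `<=` @cylinder m].

Definition is_hamiltonian_vf {n} (H : 'M[R]_(n, 2) -> R)
    (X : 'M[R]_(n, 2) -> 'M[R]_(n, 2)) : Prop :=
  forall z v, omega0 (X z) v = 'd H z v.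

Definition is_flow {n} (X : 'M[R]_(n, 2) -> 'M[R]_(n, 2))
    (Phi : R -> 'M[R]_(n, 2) -> 'M[R]_(n, 2)) : Prop :=
  forall z, Phi 0 z = z /\
    forall t : R, is_derive t 1 (fun s : R => Phi s z) (X (Phi t z)).

Definition is_time1_map {n} (H : 'M[R]_(n, 2) -> R)
    (phi : 'M[R]_(n, 2) -> 'M[R]_(n, 2)) : Prop :=
  exists X Phi, [/\ is_hamiltonian_vf H X, is_flow X Phi & phi = Phi 1].

Definition osc {n} (H : 'M[R]_(n, 2) -> R) : \bar R :=
  (ereal_sup (range (EFin \o H)) - ereal_inf (range (EFin \o H)))%E.

Definition mu (T : set (R * R)) : \bar R :=
  ((@lebesgue_measure R) \x (@lebesgue_measure R))%E T.

Definition bounded_components (A : set (R * R)) : set (set (R * R)) :=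
  [set C | bounded_set C /\ exists2 q, A q & C = connected_component A q].

Definition hull (T : set (R * R)) : set (R * R) :=
  closure T `|` \bigcup_(C in bounded_components (~` closure T)) C.

Definition mu_hat (T : set (R * R)) : \bar R := mu (hull T).

Definition slice_sup {m} (nu : set (R * R) -> \bar R) (a : R)
    (phi : 'M[R]_(m.+1, 2) -> 'M[R]_(m.+1, 2)) : \bar R :=
  ereal_sup [set nu (proj1 @` (phi @` (@cball m.+1 a) `&` disc x))
            | x in [set: 'M[R]_(m, 2)]].

(* For H in [Hc H] the map phi is uniquely determined by H, so quantifying over
   the pairs (H, phi) amounts to quantifying over H. For n >= 1, [n.-1.+1] is
   n. *)
Definition sigma_of (nu : set (R * R) -> \bar R) (n : nat) (a : R) : \bar R :=
  ereal_inf [set s | exists (H : 'M[R]_(n.-1.+1, 2) -> R) phi,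
    [/\ Hc H, is_time1_map H phi & s = (slice_sup nu a phi + osc H)%E]].

Definition sigmaH : nat -> R -> \bar R := sigma_of mu.

Definition sigmaH_hat : nat -> R -> \bar R := sigma_of mu_hat.

End Hamiltonian.

(* Main.v *)
(* The Hamiltonian is H = e * chi * sin (L x_2 + x_1), where chi is a cutoff that
   is 1 on a large part of the cylinder, e is small and A = e * L is large. Its
   oscillation is at most 2e. Where chi = 1, the flow fixes every x_i, moves
   y_2 by - A cos (L x_2 + x_1), and moves y_1 by at most e. Hence a point of the
   image of the ball lying over a fixed (x_2, y_2) satisfies
   |y_2 + A cos (L x_2 + x_1)| <= 1, which confines x_1 to two intervals of length
   O(A^(-1/2)): the slice lies in two thin vertical strips. All other points
   start, hence remain, near the boundary circle of the disc, in an annulus of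
   small area; for a < pi the ball avoids this annulus altogether. A bounded
   complementary component cannot leave a union of vertical strips, so in that
   case the hull of the slice is just as thin. *)
Require Import Defs.
From mathcomp Require Import all_boot all_order all_algebra.
From mathcomp Require Import all_classical all_reals all_analysis.
From mathcomp Require Import measurable_realfun ring lra.
Set Implicit Arguments.
Unset Strict Implicit.
Unset Printing Implicit Defensive.
Import Order.TTheory GRing.Theory Num.Theory.
Import numFieldNormedType.Exports.
Local Open Scope classical_set_scope.
Local Open Scope ring_scope.

(** * Calculus in one variable *)

Section one_variable.
Context {R : realType}.
Implicit Types (f g : R -> R) (a b t : R).

(** The infimum ranges over Hamiltonians together with an actual global flow, so a flow has to be
    constructed; this is the purpose of the Picard iteration. A violent shear is cheap because the
    frequency [L] multiplies only [x_2]: the speed of [y_2] is of order [e * L], while the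
    Hamiltonian and the speeds of [x_1] and [y_1] are at most [e] times a constant that ignores [L].
    The obstacle is to choose the constants without a circle, since cutting off costs derivatives.
    The width [k] of the annulus comes first and fixes the bound [B1] on the derivative of the inner
    cutoff; then [e] is taken small against [k / (2 * B1 + 1)]; then [L] is [A / e], which yields a
    bound [s] on the drift of the remaining coordinates; last comes the size [Q] of the outer
    plateau, large enough to hold all orbits. No circle arises because the derivative bound for the
    outer cutoff is uniform in [Q]. The two ranges of [a] differ because a thin annulus has small
    area but its hull is a full disc. *)

Lemma is_derive_continuous (V : normedModType R) (f df : R -> V) :
  (forall t, is_derive t 1 f (df t)) -> continuous f.
Proof.
move=> fd t; apply/differentiable_continuous/derivable1_diffP.
by case: (fd t).
Qed.

Lemma lipschitz_le_continuous (V W : normedModType R) (X : V -> W) (C : R) :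
  (forall z w, `|X z - X w| <= C * `|z - w|) -> continuous X.
Proof.
move=> XC z; apply/cvgrPdist_le => e e0.
have C0 : 0 < `|C| + 1 by rewrite ltr_wpDl.
apply/nbhs_normP; exists ((`|C| + 1)^-1 * e) => /=.
  by rewrite mulr_gt0// invr_gt0.
move=> w /ltW; rewrite ler_pdivlMl//; apply: le_trans.
apply: (le_trans (XC z w)); rewrite ler_wpM2r//.
by have := ler_norm C; lra.
Qed.

Lemma ger0_is_derive_le f df a b : a <= b ->
  (forall t, is_derive t 1 f (df t)) ->
  (forall t, a <= t <= b -> 0 <= df t) -> f a <= f b.
Proof.
move=> ab fd df0.
have [c cab E] := @MVT_segment R f df a b ab (fun x _ => fd x)
  (continuous_subspaceT (is_derive_continuous fd)).
by rewrite -subr_ge0 E mulr_ge0 ?subr_ge0// df0// -in_itv.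
Qed.

Lemma is_derive_norm_le f df g dg a b : a <= b ->
  (forall t, is_derive t 1 f (df t)) -> (forall t, is_derive t 1 g (dg t)) ->
  (forall t, a <= t <= b -> `|df t| <= dg t) -> `|f b - f a| <= g b - g a.
Proof.
move=> ab fd gd le; rewrite ler_norml; apply/andP; split.
  have : (fun t => g t + f t) a <= (fun t => g t + f t) b.
    apply: (@ger0_is_derive_le _ (fun t => dg t + df t)) => // t tab.
    by have := le t tab; rewrite ler_norml; lra.
  by move=> /=; lra.
have : (fun t => g t - f t) a <= (fun t => g t - f t) b.
  apply: (@ger0_is_derive_le _ (fun t => dg t - df t)) => // t tab.
  by have := le t tab; rewrite ler_norml; lra.
by move=> /=; lra.
Qed.

Lemma lipschitz_is_derive f df C : (forall t, is_derive t 1 f (df t)) ->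
  (forall t, `|df t| <= C) -> forall a b, `|f b - f a| <= C * `|b - a|.
Proof.
move=> fd fC a b; wlog ab : a b / a <= b => [H|].
  have [/H//|/ltW/H] := leP a b.
  by rewrite distrC => /le_trans; apply; rewrite distrC.
rewrite (ger0_norm (_ : 0 <= b - a)) ?subr_ge0// mulrBr.
apply: (@is_derive_norm_le f df (fun t => C * t) (fun=> C)) => // t.
by apply: is_derive_eq; rewrite /GRing.scale/= mulr1.
Qed.

Lemma continuous_antiderivative f : continuous f ->
  exists F : R -> R, F 0 = 0 /\ forall t, is_derive t 1 F (f t).
Proof.
move=> cf.
have fi a b : lebesgue_measure.-integrable `[a, b] (EFin \o f).
  apply: continuous_compact_integrable; first exact: segment_compact.
  exact: continuous_subspaceT.
pose G a t := (\int[lebesgue_measure]_(x in [set` `[a, t]]) f x)%R.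
have Gd a t : a < t -> is_derive t 1 (G a) (f t).
  move=> at_; have tt : t < t + 1 by rewrite ltrDl.
  have [|d e] := @continuous_FTC1_closed R f a t _ tt (fi _ _) at_ _; first exact: cf.
  by apply: DeriveDef => //; rewrite -derive1E.
have Gs a b t : a <= b -> b <= t -> G a t = G a b + G b t.
  move=> ab bt; rewrite /G.
  have := @Rintegral_itvB R f (BLeft a) (BRight t) b (fi _ _).
  rewrite !bnd_simp => /(_ ab bt).
  rewrite (@Rintegral_itv_obnd_cbnd _ b) //; first by lra.
  have := fi b t; apply: integrableS => //.
  by apply: subset_itvr; rewrite bnd_simp.
(* The fundamental theorem is available only strictly to the right of the base point, so the base
   point moves with [t] to stay below both [0] and [t]. Subtracting the integral up to [0] removes
   the dependence on it, which is [FE]. *)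
pose F t := G (- `|t| - 1) t - G (- `|t| - 1) 0.
have FE a t : a <= 0 -> a <= t -> F t = G a t - G a 0.
  move=> a0 at_; rewrite /F; set c := - `|t| - 1.
  have c0 : c <= 0 by rewrite /c; have := normr_ge0 t; lra.
  have ct : c <= t by rewrite /c; have := lerNnormlW (lexx `|t|); lra.
  have [ac|/ltW ca] := leP a c.
    by rewrite (Gs a c t)// (Gs a c 0)//; lra.
  by rewrite (Gs c a t)// (Gs c a 0)//; lra.
exists F; split; first by rewrite /F subrr.
move=> t; pose a := - `|t| - 1.
have a0 : a <= 0 by rewrite /a; have := normr_ge0 t; lra.
have at_ : a < t by rewrite /a; have := lerNnormlW (lexx `|t|); lra.
have := Gd a t at_ => H.
apply: (@near_eq_is_derive _ _ _ (fun s => G a s - G a 0)); last first.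
  by apply: is_derive_eq; rewrite subr0.
near=> s; apply/esym/FE => //; apply: ltW.
by near: s; exact: lt_nbhsr.
Unshelve. all: by end_near. Qed.

(** The intervals of centre [u k] and radius [c k = 2 * C * 2^-1 ^+ k] are nested, because the step
    from [u k] to [u k.+1] is at most [c k.+1 = c k / 2]. The supremum of their left ends lies in
    all of them. *)
Lemma geometric_cauchy (u : nat -> R) C :
  (forall k, `|u k.+1 - u k| <= C * 2^-1 ^+ k) ->
  exists l, forall k, `|u k - l| <= 2 * C * 2^-1 ^+ k.
Proof.
move=> uC; pose c k : R := 2 * C * 2^-1 ^+ k.
have cS k : c k = 2 * c k.+1 by rewrite /c exprS; field.
have C0 : 0 <= C by have := uC 0; rewrite expr0 mulr1; exact: le_trans.
have c0 k : 0 <= c k by rewrite /c !mulr_ge0// exprn_ge0// invr_ge0.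
have uc k : `|u k.+1 - u k| <= c k.+1.
  apply: (le_trans (uC k)); rewrite le_eqVlt; apply/orP; left; apply/eqP.
  by rewrite /c exprS; field.
have lo j k : (j <= k)%N -> u j - c j <= u k - c k.
  elim: k => [|k IH]; first by rewrite leqn0 => /eqP ->.
  rewrite leq_eqVlt ltnS => /predU1P[->//|/IH] /le_trans; apply.
  by have := uc k; rewrite ler_norml (cS k); lra.
have hi j k : (j <= k)%N -> u k + c k <= u j + c j.
  elim: k => [|k IH]; first by rewrite leqn0 => /eqP ->.
  rewrite leq_eqVlt ltnS => /predU1P[->//|/IH]; apply: le_trans.
  by have := uc k; rewrite ler_norml (cS k); lra.
have lohi j k : u j - c j <= u k + c k.
  have := lo j (maxn j k) (leq_maxl _ _); have := hi k (maxn j k) (leq_maxr _ _).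
  by have := c0 (maxn j k); lra.
pose E := range (fun k => u k - c k).
exists (sup E) => k; rewrite -/(c k) ler_norml; apply/andP; split.
  suff : sup E <= u k + c k by lra.
  by apply: ge_sup; [exists (u 0 - c 0), 0|move=> _ [j _ <-]].
suff : u k - c k <= sup E by lra.
apply: ub_le_sup; last by exists k.
by exists (u 0 + c 0) => _ [j _ <-].
Qed.

End one_variable.

(** * The Picard-Lindelof theorem for matrix-valued curves *)

Section matrix_curves.
Context {R : realType} {m n : nat}.
Implicit Types (F f : R -> 'M[R]_(m, n)) (A : 'M[R]_(m, n)).

Lemma mx_norm_leP A (c : R) : 0 <= c ->
  (`|A| <= c) <-> (forall i j, `|A i j| <= c).
Proof.
move=> c0; rewrite /Num.Def.normr/= mx_normrE; split.
  by move=> /bigmax_leP[_ H] i j; exact: (H (i, j)).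
by move=> H; apply/bigmax_leP; split => // -[i j] _; exact: H.
Qed.

Lemma mx_coord_le A i j : `|A i j| <= `|A|.
Proof. exact: (mx_norm_leP A (normr_ge0 A)).1. Qed.

Lemma is_derive_mxP F f (t : R) :
  is_derive t (1 : R) F (f t) <->
  forall i j, is_derive t (1 : R) (fun s => F s i j) (f t i j).
Proof.
split=> [[d e] i j|H].
  apply: DeriveDef; first exact: (derivable_mxP F t 1).1.
  by rewrite -e derive_mx// mxE.
have d : derivable F t 1 by apply/derivable_mxP => i j; case: (H i j).
apply: DeriveDef => //; rewrite derive_mx//; apply/matrixP => i j.
by rewrite mxE; case: (H i j).
Qed.

Lemma mx_continuous_antiderivative f : continuous f ->
  exists F, F 0 = 0 /\ forall t : R, is_derive t 1 F (f t).
Proof.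
move=> cf.
have /choice[G GP] : forall ij : 'I_m * 'I_n, exists G : R -> R, G 0 = 0 /\
    forall t : R, is_derive t 1 G (f t ij.1 ij.2).
  move=> [i j]; apply: continuous_antiderivative => t /=.
  apply: (@continuous_comp _ _ _ f (fun A : 'M[R]_(m, n) => A i j)).
    exact: cf.
  exact: coord_continuous.
exists (fun t => \matrix_(i, j) G (i, j) t); split.
  by apply/matrixP => i j; rewrite !mxE (GP (i, j)).1.
move=> t; apply/is_derive_mxP => i j.
rewrite (_ : (fun _ => _) = G (i, j)); first exact: (GP (i, j)).2.
by apply/funext => s; rewrite mxE.
Qed.

Lemma mx_is_derive_norm_le F f (g dg : R -> R) a b : a <= b ->
  (forall t : R, is_derive t 1 F (f t)) -> (forall t : R, is_derive t 1 g (dg t)) ->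
  (forall t, a <= t <= b -> `|f t| <= dg t) -> `|F b - F a| <= g b - g a.
Proof.
move=> ab Ff gg le; apply/mx_norm_leP.
  rewrite subr_ge0; apply: (ger0_is_derive_le ab gg) => t tab.
  exact: le_trans (le t tab).
move=> i j; rewrite mxE [(- F a) i j]mxE.
apply: (is_derive_norm_le ab (fun t => (is_derive_mxP _ _ _).1 (Ff t) i j) gg).
by move=> t tab; apply: le_trans (le t tab); exact: mx_coord_le.
Qed.

(** Integration gains a factor [1 / a] in the norm weighted by [expR (a * |t|)]: for positive times
    compare with the antiderivative of the weight, for negative times reflect. With [a] twice the
    Lipschitz constant this is the contraction by one half. *)
Lemma mx_is_derive_exp_bound F f (C a : R) : 0 < a -> F 0 = 0 ->
  (forall t : R, is_derive t 1 F (f t)) ->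
  (forall t, `|f t| <= C * expR (a * `|t|)) ->
  forall t, `|F t| <= C / a * expR (a * `|t|).
Proof.
move=> a0 F0 Ff fC.
have C0 : 0 <= C.
  by have := fC 0; rewrite normr0 mulr0 expR0 mulr1; exact: le_trans.
have gd (s : R) : is_derive s 1 (fun s => C / a * expR (a * s)) (C * expR (a * s)).
  apply: is_derive_eq; rewrite /GRing.scale/= !mulr1.
  by field; rewrite gt_eqF.
have Ca : 0 <= C / a by rewrite divr_ge0// ltW.
have main (G g : R -> 'M[R]_(m, n)) (t : R) : 0 <= t -> G 0 = 0 ->
    (forall t : R, is_derive t 1 G (g t)) ->
    (forall t, `|g t| <= C * expR (a * `|t|)) ->
    `|G t| <= C / a * expR (a * t).
  move=> t0 G0 Gg gC.
  have /= := mx_is_derive_norm_le t0 Gg gd.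
  rewrite G0 subr0 => /(_ _)/le_trans; apply.
    by move=> s /andP[s0 _]; have := gC s; rewrite ger0_norm.
  by rewrite gerBl mulr_ge0// expR_ge0.
move=> t; have [t0|/ltW t0] := leP 0 t.
  by rewrite ger0_norm//; exact: main.
rewrite ler0_norm// -[in leLHS](opprK t).
apply: (main (fun s => F (- s)) (fun s => - f (- s))) => //.
- by rewrite oppr_ge0.
- by rewrite oppr0.
- move=> s.
  apply: (is_derive_mxP (fun s => F (- s)) (fun s => - f (- s)) s).2 => i j.
  have H := (is_derive_mxP F f (- s)).1 (Ff (- s)) i j.
  have := @is_derive1_comp _ (fun s => F s i j) -%R s _ _ H _.
  by move=> /(_ _ _)/trigger_derive; apply; rewrite mulrN1 mxE.
- by move=> s; rewrite normrN -(normrN s).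
Qed.

(* The Picard iterates contract by a factor 2 in the norm weighted by
   exp (2K|t|), so they converge on the whole line at once. *)
Lemma picard (X : 'M[R]_(m, n) -> 'M[R]_(m, n)) (B K : R) :
  (forall z, `|X z| <= B) -> (forall z w, `|X z - X w| <= K * `|z - w|) ->
  forall z, exists u : R -> 'M[R]_(m, n),
    u 0 = z /\ forall t : R, is_derive t 1 u (X (u t)).
Proof.
move=> XB XK0.
pose K' : R := `|K| + 1.
have K0 : 0 < K' by rewrite ltr_wpDl.
have XK z w : `|X z - X w| <= K' * `|z - w|.
  apply: (le_trans (XK0 z w)); rewrite ler_wpM2r// /K'.
  by have := ler_norm K; lra.
have B0 : 0 <= B := le_trans (normr_ge0 _) (XB 0).
have cX : continuous X := lipschitz_le_continuous XK.
move=> z.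
(* An integration operator chosen on all functions, with an arbitrary value on discontinuous ones,
   so that the iterates can be defined before their continuity is proved by induction. *)
have /choice[I IP] : forall f, exists F : R -> 'M[R]_(m, n), continuous f ->
    F 0 = 0 /\ forall t : R, is_derive t 1 F (f t).
  move=> f; have [cf|ncf] := pselect (continuous f).
    by have [F FP] := mx_continuous_antiderivative cf; exists F.
  by exists f.
pose u := fix u k := if k is k'.+1 then fun t => z + I (X \o u k') t else cst z.
have Xc (v : R -> 'M[R]_(m, n)) : continuous v -> continuous (X \o v).
  by move=> cv t; apply: continuous_comp; [exact: cv|exact: cX].
have uS k : continuous (u k) -> u k.+1 0 = z /\
    forall t : R, is_derive t 1 (u k.+1) (X (u k t)).
  move=> /Xc/IP[I0 Id]; split; first by rewrite /= I0 addr0.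
  by move=> t; apply: is_derive_eq; rewrite add0r.
have uc k : continuous (u k).
  elim: k => [|k /uS[_ H]]; first by move=> t; exact: cst_continuous.
  exact: is_derive_continuous H.
have u0E t : u 0 t = z by [].
clearbody u.
pose a : R := 2 * K'; have a0 : 0 < a by rewrite /a mulr_gt0.
pose E (t : R) := expR (a * `|t|).
have E1 (t : R) : 1 <= E t.
  by rewrite /E -expR0 ler_expR mulr_ge0// ltW.
(* The first difference integrates a field of norm at most [B], giving [B / a]; each further one
   gains [K' / a = 1 / 2]. *)
have du k (t : R) : `|u k.+1 t - u k t| <= B / a * 2^-1 ^+ k * E t.
  elim: k t => [|k IH] t.
    rewrite expr0 mulr1 u0E.
    have [u0 ud] := uS 0 (uc 0).
    apply: (@mx_is_derive_exp_bound (fun t => u 1 t - z)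
      (fun t => X (u 0 t))) => //.
    - by rewrite u0 subrr.
    - by move=> s; have := ud s => H; apply: is_derive_eq; rewrite subr0.
    - by move=> s; apply: (le_trans (XB _)); rewrite ler_peMr// E1.
  have [u0 ud] := uS k.+1 (uc k.+1).
  have [u0' ud'] := uS k (uc k).
  have -> : B / a * 2^-1 ^+ k.+1 = K' * (B / a * 2^-1 ^+ k) / a.
    by rewrite exprS /a; field; rewrite gt_eqF.
  apply: (@mx_is_derive_exp_bound (fun t => u k.+2 t - u k.+1 t)
      (fun t => X (u k.+1 t) - X (u k t))) => //.
  - by rewrite u0 u0' subrr.
  - by move=> s; apply: (le_trans (XK _ _)); rewrite -mulrA ler_wpM2l// ltW.
have /choice[v vP] : forall t : R, exists v : 'M[R]_(m, n), forall k,
    `|u k t - v| <= 2 * (B / a * E t) * 2^-1 ^+ k.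
  move=> t.
  have Ct : 0 <= B / a * E t.
    by rewrite mulr_ge0 ?divr_ge0// ?expR_ge0// ltW.
  have /choice[l lP] : forall ij : 'I_m * 'I_n, exists l : R, forall k,
      `|u k t ij.1 ij.2 - l| <= 2 * (B / a * E t) * 2^-1 ^+ k.
    move=> [i j]; apply: geometric_cauchy => k.
    have := mx_coord_le (u k.+1 t - u k t) i j.
    rewrite [X in `|X|]mxE [X in _ + X]mxE => /le_trans; apply.
    by apply: (le_trans (du k t)); rewrite le_eqVlt; apply/orP; left; apply/eqP; ring.
  exists (\matrix_(i, j) l (i, j)) => k; apply/mx_norm_leP.
    by rewrite !mulr_ge0// ?expR_ge0 ?exprn_ge0// ?invr_ge0// ltW.
  by move=> i j; rewrite !mxE; exact: (lP (i, j)).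
have half_small (C e : R) : 0 < e -> exists k, C * 2^-1 ^+ k <= e.
  move=> e0; have : (C * 2^-1 ^+ k : R) @[k --> \oo] --> C * 0.
    apply: cvgM; first exact: cvg_cst.
    by apply: cvg_expr; rewrite ger0_norm// ?invr_ge0// invf_lt1// ltr1n.
  rewrite mulr0 => /cvgrPdist_le/(_ _ e0)[k _ kP]; exists k.
  have := kP k (leqnn _) => /=; rewrite sub0r normrN.
  by apply: le_trans; exact: ler_norm.
(* All iterates after the first share the Lipschitz constant [B], since their derivatives are values
   of [X]. The pointwise limit inherits it, hence is continuous and can be fed back into the
   integral. *)
have vlip (s t : R) : `|v s - v t| <= B * `|s - t|.
  have ulip k : `|u k.+1 s - u k.+1 t| <= B * `|s - t|.
    apply/mx_norm_leP; first by rewrite mulr_ge0.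
    move=> i j; rewrite mxE [X in _ + X]mxE.
    apply: (@lipschitz_is_derive _ (fun t => u k.+1 t i j)
        (fun t => X (u k t) i j)).
      move=> r; apply: (is_derive_mxP (u k.+1) (fun t => X (u k t)) r).1.
      exact: (uS k (uc k)).2.
    by move=> r; exact: le_trans (mx_coord_le _ _ _) (XB _).
  apply/ler_addgt0Pr => e e0.
  have [k kP] := half_small ((2 * (B / a * E s) + 2 * (B / a * E t)) * 2^-1) e e0.
  have -> : v s - v t = (u k.+1 s - u k.+1 t) - (u k.+1 s - v s) + (u k.+1 t - v t).
    by apply/matrixP => i j; rewrite !mxE; ring.
  apply: (le_trans (ler_normD _ _)); apply: (le_trans (lerD (ler_normB _ _) (lexx _))).
  have := ulip k; have := vP s k.+1; have := vP t k.+1.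
  by move: kP; rewrite exprS; lra.
have cv : continuous v := lipschitz_le_continuous vlip.
have [F [F0 FX]] := mx_continuous_antiderivative (Xc v cv).
(* The integral equation: both [v] and [z + F] are within [B / a * 2^-1 ^+ k * E t] of [u k.+1], the
   latter because [u k.+1 - (z + F)] has derivative [X (u k) - X v]. *)
have vE : v = (fun t => z + F t).
  apply/funext => t; apply/eqP; rewrite -subr_eq0 -normr_le0.
  apply/ler_addgt0Pr => e e0; rewrite add0r.
  have [k kP] := half_small (3 * (B / a * E t)) e e0.
  have : `|u k.+1 t - (z + F t)| <= B / a * 2^-1 ^+ k * E t.
    have [u0 ud] := uS k (uc k).
    have -> : B / a * 2^-1 ^+ k = K' * (2 * (B / a) * 2^-1 ^+ k) / a.
      by rewrite /a; field; rewrite gt_eqF.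
    apply: (@mx_is_derive_exp_bound (fun t => u k.+1 t - (z + F t))
      (fun t => X (u k t) - X (v t))) => //.
    - by rewrite u0 F0 addr0 subrr.
    - move=> s; have := ud s => H; have := FX s => H'; apply: is_derive_eq.
      by rewrite add0r.
    - move=> s; apply: (le_trans (XK _ _)); rewrite -mulrA ler_wpM2l ?(ltW K0)//.
      by apply: (le_trans (vP s k)); rewrite /E !mulrA [leRHS]mulrAC.
  have := vP t k.+1; rewrite exprS.
  have -> : v t - (z + F t) = (u k.+1 t - (z + F t)) - (u k.+1 t - v t).
    by apply/matrixP => i j; rewrite !mxE; ring.
  move=> h1 h2; apply: (le_trans (ler_normB _ _)).
  have E0 : 0 <= B / a * E t * 2^-1 ^+ k.
    by rewrite !mulr_ge0// ?invr_ge0 ?expR_ge0 ?exprn_ge0 ?invr_ge0// ltW.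
  move: kP h1 h2 E0.
  set p := 2^-1 ^+ k; set q := B / a.
  by lra.
exists v; split; first by rewrite vE F0 addr0.
move=> t; rewrite {1}vE; have := FX t => H.
by apply: is_derive_eq; rewrite add0r.
Qed.

End matrix_curves.

(** * Hamiltonian flows *)

Section hamiltonian_flow.
Context {R : realType} {n : nat}.
Implicit Types (f H : 'M[R]_(n, 2) -> R) (z v w : 'M[R]_(n, 2)).

Lemma sum_ord2 (F : 'I_2 -> R) : \sum_j F j = F 0 + F 1.
Proof. by rewrite big_ord_recl big_ord1; congr (F _ + F _); exact/val_inj. Qed.

Lemma ler_norm_sum2 (G : 'I_n -> 'I_2 -> R) i j :
  `|G i j| <= \sum_i \sum_j `|G i j|.
Proof.
rewrite (bigD1 i)//= (bigD1 j)//= -addrA lerDl addr_ge0//.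
  exact: sumr_ge0.
by apply: sumr_ge0 => k _; exact: sumr_ge0.
Qed.

Lemma diff_sum_delta f z v : differentiable f z ->
  'd f z v = \sum_i \sum_j v i j * 'D_(delta_mx i j) f z.
Proof.
move=> df; rewrite [in LHS](matrix_sum_delta v) linear_sum.
apply: eq_bigr => i _; rewrite linear_sum; apply: eq_bigr => j _.
by rewrite linearZ deriveE.
Qed.

Lemma is_derive_comp_curve f (u : R -> 'M[R]_(n, 2)) (t : R) v :
  differentiable f (u t) -> is_derive t 1 u v ->
  is_derive t 1 (f \o u) ('d f (u t) v).
Proof.
move=> df [/derivable1_diffP du uv].
have dfu : differentiable (f \o u) t by exact: differentiable_comp.
apply: DeriveDef; first exact/derivable1_diffP.
by rewrite deriveE// diff_comp//= -uv deriveE.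
Qed.

Lemma mx_lipschitz f (B : R) : (forall z, differentiable f z) ->
  (forall z i j, `|'D_(delta_mx i j) f z| <= B) ->
  forall z w, `|f z - f w| <= (n * 2)%:R * B * `|z - w|.
Proof.
move=> df fB z w.
pose u (t : R) : 'M[R]_(n, 2) := w + t *: (z - w).
have ud (t : R) : is_derive t 1 u (z - w).
  apply/is_derive_mxP => i j.
  rewrite (_ : (fun s => _) = (fun s : R => w i j + s * (z i j - w i j))).
    by apply: is_derive_eq; rewrite /GRing.scale/= !mxE ?derive_id; ring.
  by apply/funext => s; rewrite !mxE.
have fud (t : R) := is_derive_comp_curve (df (u t)) (ud t).
have := @lipschitz_is_derive _ (f \o u) (fun t => 'd f (u t) (z - w))
  ((n * 2)%:R * B * `|z - w|) fud _ 0 1.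
rewrite /= /u scale0r addr0 scale1r [w + _]addrC subrK subr0 normr1 mulr1; apply => t.
rewrite diff_sum_delta//; apply: (le_trans (ler_norm_sum _ _ _)).
have -> : (n * 2)%:R * B * `|z - w| = \sum_(i < n) \sum_(j < 2) (`|z - w| * B).
  by rewrite !sumr_const !card_ord -mulrnA -mulr_natl mulnC; ring.
apply: ler_sum => i _; apply: (le_trans (ler_norm_sum _ _ _)).
apply: ler_sum => j _; rewrite normrM ler_pM//; exact: mx_coord_le.
Qed.

Lemma derive_supp f v z : ~ supp f z -> 'D_v f z = 0.
Proof.
move=> sz; rewrite -(derive_cst (0 : R) z v); apply: near_eq_derive.
have : nbhs z (~` supp f).
  by apply: open_nbhs_nbhs; split => //; rewrite openC; exact: closed_closure.
apply: filterS => w sw; apply/eqP/negPn/negP => fw.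
by apply: sw; exact: subset_closure.
Qed.

Lemma continuous_supp_bounded (A : set 'M[R]_(n, 2)) f :
  compact A -> continuous f -> (forall z, ~ A z -> f z = 0) ->
  exists B, forall z, `|f z| <= B.
Proof.
move=> cA cf f0.
have /compact_bounded[B [Breal BP]] : compact (f @` A).
  by apply: continuous_compact => //; exact: continuous_subspaceT.
have B0 : B <= `|B| := ler_norm B.
exists (`|B| + 1) => z; have [Az|/f0 ->] := pselect (A z); last first.
  by rewrite normr0 addr_ge0.
by apply: (BP (`|B| + 1)); [rewrite (le_lt_trans B0)// ltrDl|exists z].
Qed.

Lemma smooth_derive f v : smooth f -> smooth (fun z => 'D_v f z).
Proof. by move=> sf k; have [_] := sf k.+1; exact. Qed.

Lemma smooth_differentiable f z : smooth f -> differentiable f z.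
Proof. by move=> /(_ 1%N)[]. Qed.

Definition ham_vf H z : 'M[R]_(n, 2) := \matrix_(i, j)
  if j == 0 then 'D_(delta_mx i 1) H z else - 'D_(delta_mx i 0) H z.

Lemma ham_vfP H : (forall z, differentiable H z) ->
  is_hamiltonian_vf H (ham_vf H).
Proof.
move=> dH z v; rewrite diff_sum_delta//; apply: eq_bigr => i _.
by rewrite sum_ord2 !mxE/=; ring.
Qed.

(** First and second derivatives of [H] are continuous and vanish off the compact support, so they
    are bounded. The Hamiltonian field is therefore bounded and globally Lipschitz, as [picard]
    demands. *)
Lemma ham_flow_exists H : smooth H -> compact (supp H) ->
  exists Phi, is_flow (ham_vf H) Phi.
Proof.
move=> sH cH.
have /choice[B BP] : forall v, exists B, forall z, `|'D_v H z| <= B.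
  move=> v; apply: (continuous_supp_bounded cH).
    exact: (smooth_derive v sH 0%N).
  by move=> z; exact: derive_supp.
have /choice[L LP] : forall v, exists L, forall z w,
    `|'D_v H z - 'D_v H w| <= L * `|z - w|.
  move=> v.
  have /choice[C CP] : forall ij : 'I_n * 'I_2, exists C, forall z,
      `|'D_(delta_mx ij.1 ij.2) (fun z => 'D_v H z) z| <= C.
    move=> [i j]; apply: (continuous_supp_bounded cH).
      exact: (smooth_derive _ (smooth_derive v sH) 0%N).
    move=> z; apply: contra_notP => nz; apply: contrapT => sz; apply: nz.
    rewrite -(derive_cst (0 : R) z (delta_mx i j)); apply: near_eq_derive.
    have : nbhs z (~` supp H).
      by apply: open_nbhs_nbhs; split => //; rewrite openC; exact: closed_closure.
    by apply: filterS => w sw; exact: derive_supp.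
  pose D : R := \sum_i \sum_j `|C (i, j)|.
  exists ((n * 2)%:R * D) => z w.
  apply: (@mx_lipschitz (fun z => 'D_v H z) D) => [x|x i j].
    exact: (smooth_differentiable x (smooth_derive v sH)).
  apply: (le_trans (CP (i, j) x)); rewrite (le_trans (ler_norm _))//.
  exact: (ler_norm_sum2 (fun i j => C (i, j))).
have XB z : `|ham_vf H z| <= \sum_i \sum_j `|B (delta_mx i j)|.
  apply/mx_norm_leP => [|i j]; first by do 2 apply: sumr_ge0 => ? _.
  rewrite mxE; case: ifP => _; rewrite ?normrN;
    exact: le_trans (BP _ _) (le_trans (ler_norm _)
      (ler_norm_sum2 (fun i j => _ (delta_mx i j)) _ _)).
have XL z w : `|ham_vf H z - ham_vf H w| <=
    (\sum_i \sum_j `|L (delta_mx i j)|) * `|z - w|.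
  apply/mx_norm_leP => [|i j].
    by rewrite mulr_ge0//; do 2 apply: sumr_ge0 => ? _.
  rewrite !mxE; case: ifP => _; last rewrite -opprD normrN;
    apply: (le_trans (LP _ _ _));
    by rewrite ler_wpM2r// (le_trans (ler_norm _)
      (ler_norm_sum2 (fun i j => _ (delta_mx i j)) _ _)).
have /choice[u uP] := picard XB XL.
by exists (fun t z => u z t) => z; have [u0 ud] := uP z.
Qed.

End hamiltonian_flow.

(** * Smooth functions and cutoffs *)

Section Ck_calculus.
Context {R : realType} {n : nat}.
Implicit Types f g : 'M[R]_(n, 2) -> R.

Lemma Ck_pred k f : Ck k.+1 f -> Ck k f.
Proof.
elim: k f => [|k IH] f [df Df].
  by move=> z; exact: differentiable_continuous.
by split => // v; exact/IH/Df.
Qed.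

Lemma Ck_differentiable k f z : Ck k.+1 f -> differentiable f z.
Proof. by case. Qed.

Lemma eq_Ck k f g : f =1 g -> Ck k g -> Ck k f.
Proof. by move=> /funext ->. Qed.

Lemma Ck_cst k (c : R) : Ck k (fun _ : 'M[R]_(n, 2) => c).
Proof.
elim: k c => [|k IH] c; first by move=> z; exact: cst_continuous.
split=> [z|v]; first exact: differentiable_cst.
by apply: (@eq_Ck _ _ (fun=> 0)) => // z; exact: derive_cst.
Qed.

Lemma CkD k f g : Ck k f -> Ck k g -> Ck k (fun z => f z + g z).
Proof.
elim: k f g => [|k IH] f g; first by move=> cf cg z;
  apply: continuousD; [exact: cf|exact: cg].
move=> [df Df] [dg Dg]; split=> [z|v]; first exact: differentiableD (df z) (dg z).
apply: (@eq_Ck _ _ (fun z => 'D_v f z + 'D_v g z)); last first.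
  by apply: IH; [exact: Df|exact: Dg].
by move=> z; rewrite deriveD//; exact: diff_derivable.
Qed.

Lemma CkM k f g : Ck k f -> Ck k g -> Ck k (fun z => f z * g z).
Proof.
elim: k f g => [|k IH] f g; first by move=> cf cg z;
  apply: continuousM; [exact: cf|exact: cg].
move=> Cf Cg; have [df Df] := Cf; have [dg Dg] := Cg.
split=> [z|v]; first exact: differentiableM (df z) (dg z).
apply: (@eq_Ck _ _ (fun z => f z * 'D_v g z + g z * 'D_v f z)); last first.
  apply: CkD; apply: IH; [exact: Ck_pred|exact: Dg|exact: Ck_pred|exact: Df].
by move=> z; rewrite deriveM//; exact: diff_derivable.
Qed.

Lemma Ck_sum k (I : Type) (r : seq I) (P : pred I) (F : I -> 'M[R]_(n, 2) -> R) :
  (forall i, P i -> Ck k (F i)) -> Ck k (fun z => \sum_(i <- r | P i) F i z).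
Proof.
move=> CF; elim: r => [|i r IH].
  apply: (@eq_Ck _ _ (fun=> 0)); last exact: Ck_cst.
  by move=> z; rewrite big_nil.
apply: (@eq_Ck _ _ (fun z => (if P i then F i z else 0) +
    \sum_(i <- r | P i) F i z)).
  by move=> z; rewrite big_cons; case: ifP => _; rewrite ?add0r.
apply: (@CkD k (fun z => if P i then F i z else 0)) => //.
by case Pi : (P i); [exact: CF|exact: Ck_cst].
Qed.

Lemma derive_coord (i : 'I_n) (j : 'I_2) (z v : 'M[R]_(n, 2)) :
  'D_v (fun z : 'M[R]_(n, 2) => z i j) z = v i j.
Proof.
rewrite deriveE; last exact: differentiable_coord.
have @f : {linear 'M[R]_(n, 2) -> R}.
  by exists (fun N : 'M[R]_(_, _) => N i j); do 2![eexists]; do ?[constructor];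
     rewrite ?mxE// => ? *; rewrite ?mxE//; move=> ?; rewrite !mxE.
rewrite (_ : (fun z : 'M[R]_(n, 2) => z i j) = f)// diff_lin//.
exact: coord_continuous.
Qed.

Lemma Ck_coord k (i : 'I_n) (j : 'I_2) : Ck k (fun z : 'M[R]_(n, 2) => z i j).
Proof.
case: k => [|k]; first exact: coord_continuous.
split=> [z|v]; first exact: differentiable_coord.
apply: (@eq_Ck _ _ (fun=> v i j)); last exact: Ck_cst.
by move=> z; exact: derive_coord.
Qed.

Lemma is_derive_comp_dir (h dh : R -> R) f (z v : 'M[R]_(n, 2)) : differentiable f z ->
  (forall t : R, is_derive t 1 h (dh t)) ->
  differentiable (fun z => h (f z)) z /\
  'D_v (fun z => h (f z)) z = dh (f z) * 'D_v f z.
Proof.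
move=> df hd; have [/derivable1_diffP dhf e] := hd (f z).
split; first exact: differentiable_comp.
have E r : 'd h (f z) r = dh (f z) * r.
  by rewrite -{1}(mulr1 r) -[r * 1]/(r *: (1 : R)) linearZ/= -deriveE// e mulrC.
rewrite deriveE; last exact: differentiable_comp.
by rewrite diff_comp//= E deriveE.
Qed.

(** The outer function comes as a whole sequence of successive derivatives, so that the induction on
    [k] closes: the chain rule replaces [h j] by [h j.+1]. It is applied to [flat_derivs] and to the
    family [sin (t + j * pi / 2)]. *)
Lemma Ck_comp k (h : nat -> R -> R) j f :
  (forall j (t : R), is_derive t 1 (h j) (h j.+1 t)) ->
  Ck k f -> Ck k (fun z => h j (f z)).
Proof.
move=> hd; elim: k j f => [|k IH] j f.
  move=> cf z; apply: (@continuous_comp _ _ _ f (h j)); first exact: cf.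
  exact: (is_derive_continuous (hd j)).
move=> Cf; have [df Df] := Cf; split=> [z|v].
  by have [] := is_derive_comp_dir 0 (df z) (hd j).
apply: (@eq_Ck _ _ (fun z => h j.+1 (f z) * 'D_v f z)); last first.
  apply: CkM; last exact: Df.
  by apply: IH; exact: Ck_pred.
by move=> z; have [] := is_derive_comp_dir v (df z) (hd j).
Qed.

End Ck_calculus.

(** * A smooth step function with bounded derivative *)

Section cutoff.
Context {R : realType}.
Implicit Types (p : {poly R}) (s t : R).

(** Coefficient by coefficient, from [s ^+ i <= i! * expR s], a single term of the exponential
    series. *)
Lemma poly_expRN_bounded p : exists C, forall s, 0 < s -> `|p.[s] * expR (- s)| <= C.
Proof.
exists (\sum_(i < size p) `|p`_i| * i`!%:R) => s s0.
rewrite normrM (ger0_norm (expR_ge0 _)) expRN ler_pdivrMr ?expR_gt0//.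
rewrite horner_coef mulr_suml; apply: (le_trans (ler_norm_sum _ _ _)).
apply: ler_sum => i _; rewrite normrM -mulrA ler_wpM2l//.
rewrite (ger0_norm (exprn_ge0 _ (ltW s0))) [leRHS]mulrC -ler_pdivrMr ?ltr0n ?fact_gt0//.
have [->|] := eqVneq (i : nat) 0%N.
  by rewrite expr0 fact0 invr1 mulr1 ltW// -expR0 ltr_expR.
case: (i : nat) => // k _.
by rewrite (le_trans _ (expR_ge1Dxn k (ltW s0)))// lerDr.
Qed.

(* The family of the functions p(1/t) exp(-1/t), extended by 0 to t <= 0, is
   stable under differentiation. *)
Definition flat_poly p t : R := if 0 < t then p.[t^-1] * expR (- t^-1) else 0.

(** For positive [t] the chain rule produces [t^-2] times [p - p'] evaluated at [1/t], which
    accounts for the new polynomial. The only delicate point is [t = 0]. *)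
Lemma is_derive_flat_poly p t :
  is_derive t 1 (flat_poly p) (flat_poly ('X^2 * (p - p^`())) t).
Proof.
have [t0|t0|->] := ltgtP t 0.
- rewrite /flat_poly ltNge (ltW t0)/=.
  apply: (@near_eq_is_derive _ _ _ (cst 0)).
  by near=> s; rewrite /flat_poly ltNge ltW//; near: s; exact: lt_nbhsl.
- rewrite {2}/flat_poly t0.
  apply: (@near_eq_is_derive _ _ _ (fun s => p.[s^-1] * expR (- s^-1))).
    by near=> s; rewrite /flat_poly ifT//; near: s; exact: lt_nbhsr.
  have tn0 : t != 0 by rewrite gt_eqF.
  have iv : is_derive t 1 (@GRing.inv R) (- t^-2).
    apply: DeriveDef; first by apply: derivableV.
    by rewrite deriveV// derive_id /GRing.scale/= mulr1.
  have d1 := is_derive1_comp (is_derive_poly p t^-1) iv.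
  have d2 := @is_derive1_comp _ expR (- (@GRing.inv R)) t _ _
    (is_derive_expR _) (is_deriveN iv).
  have d3 : is_derive t 1 (fun s => p.[s^-1] * expR (- s^-1))
      (p.[t^-1] * (expR (- t^-1) * - - t ^- 2) +
       expR (- t^-1) * (p^`().[t^-1] * - t ^- 2)) := is_deriveM d1 d2.
  by apply: trigger_derive d3 _; rewrite hornerM hornerXn hornerD hornerN exprVn; ring.
- rewrite /flat_poly ltxx.
  have [C CP] := poly_expRN_bounded ('X^2 * p).
  suff H : h^-1 *: (flat_poly p (h *: 1 + 0) - flat_poly p 0) @[h --> 0^'] --> 0.
    apply: DeriveDef; first by apply/cvg_ex; exists 0.
    exact: cvg_lim H.
  apply/cvgrPdist_le => e e0.
  have C0 : 0 < `|C| + 1 by rewrite ltr_wpDl.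
  near=> h.
  rewrite sub0r normrN /flat_poly ltxx subr0 addr0 /GRing.scale/= mulr1.
  case: ifPn => [h0|]; last by rewrite mulr0 normr0 ltW.
  (* Raising the degree by two trades the factor [1/h] of the difference quotient for a factor [h]
     in front of a bounded function. *)
  have -> : h^-1 * (p.[h^-1] * expR (- h^-1)) =
      h * (('X^2 * p).[h^-1] * expR (- h^-1)).
    by rewrite hornerM hornerXn; field; rewrite gt_eqF.
  rewrite normrM; have hinv : 0 < h^-1 by rewrite invr_gt0.
  apply: (@le_trans _ _ (`|h| * (`|C| + 1))).
    rewrite ler_wpM2l// (le_trans (CP _ hinv))//.
    by have := ler_norm C; lra.
  rewrite -ler_pdivlMr//; near: h.
  by apply: dnbhs0_le; rewrite divr_gt0.
Unshelve. all: by end_near. Qed.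

Definition flat : R -> R := flat_poly 1.

Definition flat_derivs (k : nat) : R -> R :=
  flat_poly (iter k (fun p => 'X^2 * (p - p^`())) 1).

Lemma is_derive_flat_derivs k t :
  is_derive t 1 (flat_derivs k) (flat_derivs k.+1 t).
Proof. exact: is_derive_flat_poly. Qed.

Lemma flat_eq0 t : t <= 0 -> flat t = 0.
Proof. by move=> t0; rewrite /flat /flat_poly ltNge t0. Qed.

Lemma flat_gt0 t : 0 < t -> 0 < flat t.
Proof. by move=> t0; rewrite /flat /flat_poly t0 hornerE ?mul1r expR_gt0. Qed.

Lemma flat_ge0 t : 0 <= flat t.
Proof. by have [/flat_eq0->//|/flat_gt0/ltW] := leP t 0. Qed.

Lemma flat_le : {homo flat : s t / s <= t}.
Proof.
move=> s t st; have [/flat_eq0->|s0] := leP s 0; first exact: flat_ge0.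
have t0 := lt_le_trans s0 st.
rewrite /flat /flat_poly s0 t0 !hornerE ?mul1r ler_expR lerN2.
by rewrite lef_pV2.
Qed.

(* flat (1 - flat) is constant where the inner flat vanishes, and vanishes
   where the inner flat exceeds 1: this gives a step without any division of
   functions. *)
Definition cutoff (a b t : R) : R :=
  expR 1 * flat (1 - flat (t - a) / flat (b - a)).

Definition dcutoff (a b t : R) : R :=
  - (expR 1 * flat_derivs 1 (1 - flat (t - a) / flat (b - a)) *
     (flat_derivs 1 (t - a) / flat (b - a))).

Lemma is_derive_cutoff a b t : is_derive t 1 (cutoff a b) (dcutoff a b t).
Proof.
pose g s : R := s - a; pose c := flat (b - a); pose k s := 1 - flat (g s) / c.
have d0 : is_derive t 1 g 1 by apply: is_derive_eq; rewrite subr0.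
have d1 := @is_derive1_comp _ (flat_derivs 0) g t _ _
  (is_derive_flat_derivs 0 (g t)) d0.
have d2 : is_derive t 1 k (- (flat_derivs 1 (t - a) / c)).
  have -> : k = (fun s => 1 - c^-1 * (flat_derivs 0 \o g) s).
    by apply/funext => s; rewrite /k mulrC.
  apply: is_derive_eq; rewrite /GRing.scale/=.
  by rewrite /g; ring.
have d3 := @is_derive1_comp _ (flat_derivs 0) k t _ _
  (is_derive_flat_derivs 0 (k t)) d2.
have -> : cutoff a b = (fun s => expR 1 * (flat_derivs 0 \o k) s) by [].
apply: is_derive_eq; rewrite /GRing.scale/= /dcutoff -/c -/(g t) -/(k t).
by ring.
Qed.

Lemma Ck_cutoff n k a b (f : 'M[R]_(n, 2) -> R) :
  Ck k f -> Ck k (fun z => cutoff a b (f z)).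
Proof.
move=> Cf; apply: CkM; first exact: Ck_cst.
apply: (@Ck_comp _ _ _ flat_derivs 0); first exact: is_derive_flat_derivs.
have -> : (fun z => 1 - flat (f z - a) / flat (b - a)) =
    (fun z => 1 + - (flat (b - a))^-1 * flat (f z + - a)).
  by apply/funext => z; rewrite mulNr mulrC.
apply: CkD; first exact: Ck_cst.
apply: CkM; first exact: Ck_cst.
apply: (@Ck_comp _ _ _ flat_derivs 0); first exact: is_derive_flat_derivs.
by apply: CkD => //; exact: Ck_cst.
Qed.

(** On this side the inner [flat] vanishes and [flat 1 = expR (-1)]; this is the value that the
    factor [expR 1] in [cutoff] normalises. *)
Lemma cutoff_eq1 a b t : t <= a -> cutoff a b t = 1.
Proof.
move=> ta; rewrite /cutoff (flat_eq0 (_ : t - a <= 0)) ?subr_le0// mul0r subr0.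
by rewrite /flat /flat_poly ltr01 -polyC1 hornerC mul1r invr1 -expRD subrr expR0.
Qed.

Lemma dcutoff_eq0l a b t : t <= a -> dcutoff a b t = 0.
Proof.
move=> ta; rewrite /dcutoff [X in _ * (X / _)]/flat_derivs /flat_poly.
by rewrite subr_gt0 ltNge ta/= mul0r mulr0 oppr0.
Qed.

Lemma flat_ratio_ge1 a b t : a < b -> b <= t -> 1 - flat (t - a) / flat (b - a) <= 0.
Proof.
move=> ab bt; rewrite subr_le0 ler_pdivlMr ?flat_gt0 ?subr_gt0// mul1r.
by apply: flat_le; rewrite lerB.
Qed.

Lemma cutoff_eq0 a b t : a < b -> b <= t -> cutoff a b t = 0.
Proof. by move=> ab bt; rewrite /cutoff flat_eq0 ?mulr0// flat_ratio_ge1. Qed.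

Lemma dcutoff_eq0r a b t : a < b -> b <= t -> dcutoff a b t = 0.
Proof.
move=> ab bt; rewrite /dcutoff [X in _ * X * _]/flat_derivs /flat_poly.
by rewrite ltNge flat_ratio_ge1//= mulr0 mul0r oppr0.
Qed.

Lemma cutoff_ge0 a b t : 0 <= cutoff a b t.
Proof. by rewrite mulr_ge0 ?expR_ge0 ?flat_ge0. Qed.

Lemma cutoff_le1 a b t : cutoff a b t <= 1.
Proof.
have <- : cutoff a b a = 1 by exact: cutoff_eq1.
rewrite /cutoff ler_wpM2l ?expR_ge0//; apply: flat_le.
rewrite lerD2l lerN2 ler_wpM2r ?invr_ge0 ?flat_ge0// subrr.
by rewrite (flat_eq0 (lexx 0)) flat_ge0.
Qed.

Lemma dcutoff_bounded a b : exists2 B, 0 <= B & forall t, `|dcutoff a b t| <= B.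
Proof.
have [C CP] : exists C, forall t, `|flat_derivs 1 t| <= C.
  have [C CP] := poly_expRN_bounded ('X^2 * (1 - 1^`())).
  exists `|C| => t; rewrite /flat_derivs /flat_poly/=; case: ifPn => t0.
    by rewrite (le_trans (CP _ _)) ?invr_gt0// ler_norm.
  by rewrite normr0.
have C0 : 0 <= C := le_trans (normr_ge0 _) (CP 0).
exists (expR 1 * C * (C / flat (b - a))).
  by rewrite !mulr_ge0 ?expR_ge0 ?invr_ge0 ?flat_ge0.
move=> t; rewrite /dcutoff normrN !normrM normfV.
rewrite !(ger0_norm (flat_ge0 _)) (ger0_norm (expR_ge0 _)).
by rewrite ler_pM ?mulr_ge0 ?ler_wpM2l ?expR_ge0 ?ler_wpM2r ?invr_ge0 ?flat_ge0.
Qed.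

End cutoff.

(** * Oscillation, area and hulls *)

Section oscillation.
Context {R : realType}.
Implicit Types t u p q : R.

Lemma sin_le_id t : 0 <= t -> sin t <= t.
Proof.
move=> t0.
have : (fun s : R => s - sin s) 0 <= (fun s : R => s - sin s) t.
  by apply: (@ger0_is_derive_le _ (fun s => s - sin s) (fun s => 1 - cos s)).
by rewrite /= sin0 subr0 subr_ge0.
Qed.

(** The difference [sin s - s / 2] is nondecreasing on the unit interval, because there [cos s = 1 -
    2 * sin (s / 2) ^+ 2 >= 1 - s ^+ 2 / 2 >= 1 / 2]. *)
Lemma sin_ge_half t : 0 <= t <= 1 -> t / 2 <= sin t.
Proof.
move=> /andP[t0 t1].
have : (fun s : R => sin s - s * 2^-1) 0 <= (fun s : R => sin s - s * 2^-1) t.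
  apply: (@ger0_is_derive_le _ (fun s => sin s - s * 2^-1)
    (fun s => cos s - 2^-1)) => // s.
    by apply: is_derive_eq; rewrite /GRing.scale/= ?mulr1; ring.
  move=> /andP[s0 st].
  have h0 : 0 <= s / 2 by rewrite divr_ge0.
  have s1 : 0 <= sin (s / 2).
    apply: sin_ge0_pi; rewrite h0/=.
    by apply: (@le_trans _ _ 2); [lra|exact: pi_ge2].
  have s2 := sin_le_id h0.
  have : sin (s / 2) ^+ 2 <= (s / 2) ^+ 2 by rewrite ler_pXn2r// nnegrE.
  have -> : cos s = 1 - 2 * sin (s / 2) ^+ 2.
    rewrite [in LHS](_ : s = s / 2 + s / 2); last by field.
    by rewrite cosD -!expr2 cos2sin2; ring.
  have : s ^+ 2 <= 1 by rewrite expr_le1//; lra.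
  by rewrite exprMn exprVn; nra.
by rewrite /= sin0 mul0r subr0 subr_ge0.
Qed.

Lemma norm_sin_ge_half t : `|t| <= 1 -> `|t| <= 2 * `|sin t|.
Proof.
wlog t0 : t / 0 <= t => [H t1|].
  have [/H/(_ t1)//|/ltW t0] := leP 0 t.
  by have := H (- t); rewrite sinN !normrN oppr_ge0; apply.
rewrite (ger0_norm t0) => t1; have := @sin_ge_half t; rewrite t0 t1 => /(_ isT).
by have := ler_norm (sin t); lra.
Qed.

Lemma cosB_prod p q : cos p - cos q = - (2 * (sin ((p + q) / 2) * sin ((p - q) / 2))).
Proof.
rewrite [in LHS](_ : p = (p + q) / 2 + (p - q) / 2); last by field.
rewrite [in X in _ - X](_ : q = (p + q) / 2 - (p - q) / 2); last by field.
by rewrite cosD cosB; ring.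
Qed.

(* Two solutions u, u0 of the constraint satisfy
   |sin (p + (u + u0)/2)| |sin ((u - u0)/2)| <= 1/A = e^2, so one factor is at
   most e, and each of the two cases leaves an interval. *)
Lemma cos_band_intervals (A e p q : R) : 0 < e -> A * e ^+ 2 = 1 ->
  exists c1 c2, forall u, `|u| <= 1 -> `|q + A * cos (p + u)| <= 1 ->
    `|u - c1| <= 8 * e \/ `|u - c2| <= 8 * e.
Proof.
move=> e0 Ae.
pose S u := `|u| <= 1 /\ `|q + A * cos (p + u)| <= 1.
have [[u0 [u01 Su0]]|nS] := pselect (exists u0, S u0); last first.
  by exists 0, 0 => u u1 Su; exfalso; apply: nS; exists u.
have sinbound (c d : R) : `|c| <= 1 -> `|d| <= 1 -> `|sin ((c - d) / 2)| <= 2 * e ->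
    `|c - d| <= 8 * e.
  move=> c1 d1 h.
  have cd : `|c - d| <= 2 by have := ler_normB c d; lra.
  have := @norm_sin_ge_half ((c - d) / 2).
  have -> : `|(c - d) / 2| = `|c - d| / 2 by rewrite normrM (ger0_norm (_ : 0 <= 2^-1)).
  have cd1 : `|c - d| / 2 <= 1 by lra.
  by move=> /(_ cd1); lra.
have split_ u : S u ->
    `|sin (p + (u + u0) / 2)| <= e \/ `|sin ((u - u0) / 2)| <= e.
  move=> [u1 Su].
  have := cosB_prod (p + u) (p + u0).
  have -> : (p + u + (p + u0)) / 2 = p + (u + u0) / 2 by field.
  have -> : (p + u - (p + u0)) / 2 = (u - u0) / 2 by field.
  set x := sin _; set y := sin _ => E.
  have A0 : 0 < A.
    by have := @ltr01 R; rewrite -Ae pmulr_lgt0// exprn_gt0.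
  have : A * (`|x| * `|y|) <= 1.
    rewrite -normrM -[A in A * _](gtr0_norm A0) -normrM.
    have -> : A * (x * y) = ((q + A * cos (p + u0)) - (q + A * cos (p + u))) / 2.
      have -> : cos (p + u) = cos (p + u0) - 2 * (x * y) by rewrite -E; ring.
      by field.
    move: Su Su0; rewrite !ler_norml; lra.
  have [|xe] := leP `|x| e; first by left.
  have [|ye] := leP `|y| e; first by right.
  rewrite -Ae ler_pM2l// leNgt expr2 => /negP[].
  by rewrite ltr_pM// ltW.
(* The second centre is any [u1] for which the first factor is small. For another such [u] the
   arguments of the two sines differ by [(u - u1) / 2], whose sine is at most [2 * e] by the
   subtraction formula. If there is no such [u1], the interval around [u0] holds everything. *)
have [[u1 [Su1 x1]]|nu1] :=
    pselect (exists u1, S u1 /\ `|sin (p + (u1 + u0) / 2)| <= e).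
  exists u1, u0 => u uu1 Su; have [x|y] := split_ u (conj uu1 Su).
    left; apply: sinbound => //; first by case: Su1.
    have -> : (u - u1) / 2 = (p + (u + u0) / 2) - (p + (u1 + u0) / 2) by field.
    rewrite sinB (le_trans (ler_normB _ _))// !normrM mulr_natl mulr2n lerD//.
      by rewrite -[e]mulr1 ler_pM// ler_norml cos_geN1 cos_le1.
    by rewrite mulrC -[e]mulr1 ler_pM// ler_norml cos_geN1 cos_le1.
  by right; apply: sinbound => //; lra.
exists u0, u0 => u uu1 Su; left; have [x|y] := split_ u (conj uu1 Su).
  by exfalso; apply: nu1; exists u.
by apply: sinbound => //; lra.
Qed.

End oscillation.

(** * Area of strips and annuli, and hulls of sets in strips *)

Section planar_measure.
Context {R : realType}.
Notation lambda := (@lebesgue_measure R).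

Lemma le_lebesgue_measure (A B : set R) : A `<=` B -> (lambda A <= lambda B)%E.
Proof. by move=> AB; exact: le_mu_ext. Qed.

(* The library's integral of a nonnegative function is a supremum over simple
   functions, hence monotone even for nonmeasurable ones; this spares us the
   measurability of slices and hulls. *)
Lemma le_lower_integral (f g : R -> \bar R) :
  (forall x, 0 <= f x)%E -> (forall x, f x <= g x)%E ->
  (\int[lambda]_x f x <= \int[lambda]_x g x)%E.
Proof.
move=> f0 fg; have g0 x : (0 <= g x)%E := le_trans (f0 x) (fg x).
rewrite !ge0_integralTE//; apply: ge_ereal_sup => _ [h hf <-]; apply: ereal_sup_ubound.
by exists h => // x; exact: le_trans (hf x) (fg x).
Qed.

Lemma lebesgue_itvcc (a b : R) : a <= b -> lambda `[a, b]%classic = (b - a)%:E.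
Proof.
move=> ab; rewrite lebesgue_measure_itv/= lte_fin.
by move: ab; rewrite le_eqVlt => /predU1P[->|->]; rewrite ?ltxx ?subrr ?EFinB.
Qed.

(** The section lies in two intervals from [a] to [b] and their mirror images, and
    [b - a <= sqrt (1 - s)] since [b ^+ 2 <= a ^+ 2 + (1 - s)]. The bound is crude near the centre
    but uniform in [x]. Since [Num.sqrt] is [0] on negative numbers, [a] is [0] where the section
    does not meet the hole. *)
Lemma annulus_section (s x : R) : s <= 1 ->
  (lambda [set y | s <= x ^+ 2 + y ^+ 2 <= 1]%R <= (2 * Num.sqrt (1 - s))%:E)%E.
Proof.
move=> s1; pose b := Num.sqrt (1 - x ^+ 2); pose a := Num.sqrt (s - x ^+ 2).
have [x1|x1] := leP (x ^+ 2) 1; last first.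
  rewrite (_ : [set _ | _] = set0) ?measure0 ?lee_fin ?mulr_ge0//.
  apply/seteqP; split=> // y /= /andP[_]; rewrite leNgt => /negP; apply.
  by have := sqr_ge0 y; lra.
have b2 : b ^+ 2 = 1 - x ^+ 2 by rewrite sqr_sqrtr// subr_ge0.
have a0 : 0 <= a := sqrtr_ge0 _; have b0 : 0 <= b := sqrtr_ge0 _.
have ab : a <= b by rewrite ler_wsqrtr// lerB.
pose I1 := `[- b, - a]%classic : set R; pose I2 := `[a, b]%classic : set R.
apply: (@le_trans _ _ (lambda (I1 `|` I2))).
  apply: le_lebesgue_measure => y /= /andP[sy y1].
  have yb : `|y| <= b.
    by rewrite -(@ler_pXn2r _ 2)// ?nnegrE// real_normK ?num_real// b2; lra.
  have ay : a <= `|y|.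
    have [sx|sx] := leP 0 (s - x ^+ 2).
      rewrite -(@ler_pXn2r _ 2)// ?nnegrE// real_normK ?num_real// sqr_sqrtr//.
      by lra.
    by rewrite /a (ler0_sqrtr (ltW sx)).
  move: yb ay; rewrite ler_norml => /andP[? ?].
  case: (leP 0 y) => y0; [rewrite ger0_norm// => ?|rewrite ltr0_norm// => ?].
    by right; rewrite /I2 /= in_itv/=; lra.
  by left; rewrite /I1 /= in_itv/=; lra.
apply: (@le_trans _ _ (lambda I1 + lambda I2)%E).
  by apply: measureU2; exact: measurable_itv.
rewrite /I1 /I2 !lebesgue_itvcc ?lerN2// -EFinD lee_fin.
suff : b - a <= Num.sqrt (1 - s) by lra.
rewrite lerBlDr -(@ler_pXn2r _ 2)// ?nnegrE ?addr_ge0// sqrrD b2.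
rewrite sqr_sqrtr ?subr_ge0//.
have ha : s - x ^+ 2 <= a ^+ 2.
  have [sx|sx] := leP 0 (s - x ^+ 2); first by rewrite sqr_sqrtr.
  by rewrite (le_trans (ltW sx))// sqr_ge0.
have : 0 <= Num.sqrt (1 - s) * a *+ 2 by rewrite mulrn_wge0// mulr_ge0.
by lra.
Qed.

(** By the definition of the product measure it suffices to bound vertical sections. They have
    length at most [2] over the two strips of width [2 * r], and at most [2 * sqrt (1 - s)] over the
    rest of the interval from [-1] to [1]. For [s = 1] the annulus contributes nothing. *)
Lemma mu_strips_annulus (T : set (R * R)) (c1 c2 r s : R) : 0 <= r -> s <= 1 ->
  (forall x y, T (x, y) -> [/\ `|x| <= 1, `|y| <= 1 &
     [\/ `|x - c1| <= r, `|x - c2| <= r | s <= x ^+ 2 + y ^+ 2 <= 1]]) ->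
  (mu T <= (8 * r + 4 * Num.sqrt (1 - s))%:E)%E.
Proof.
move=> r0 s1 TP.
pose I c := `[c - r, c + r]%classic : set R.
pose J := `[-1, 1]%classic : set R.
pose q := 2 * Num.sqrt (1 - s).
have q0 : 0 <= q by rewrite mulr_ge0.
pose g x : R := 2 * \1_(I c1) x + 2 * \1_(I c2) x + q * \1_J x.
have lI c : lambda (I c) = (2 * r)%:E.
  rewrite lebesgue_itvcc; first by congr (_%:E); ring.
  by rewrite lerD2l; apply: (@le_trans _ _ 0) => //; rewrite oppr_le0.
have lJ : lambda J = 2%:E by rewrite lebesgue_itvcc; [congr (_%:E); ring|lra].
have i0 (A : set R) x : 0 <= \1_A x :> R by rewrite indicE.
have inI c x : `|x - c| <= r -> \1_(I c) x = 1 :> R.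
  move=> h; rewrite indicE mem_set// /I /= in_itv/=.
  by move: h; rewrite ler_norml; lra.
have le_g x : (lambda (xsection T x) <= (g x)%:E)%E.
  have [h|/not_orP[h1 h2]] := pselect (`|x - c1| <= r \/ `|x - c2| <= r).
    apply: (@le_trans _ _ (lambda J)).
      apply: le_lebesgue_measure => y; rewrite /xsection /= inE => /TP[_ + _].
      by rewrite /J /= in_itv/= -ler_norml.
    rewrite lJ lee_fin.
    have := i0 (I c1) x; have := i0 (I c2) x; have := mulr_ge0 q0 (i0 J x).
    by case: h => /inI; rewrite /g => -> ; lra.
  have [x1|x1] := leP `|x| 1; last first.
    rewrite (_ : xsection T x = set0) ?measure0 ?lee_fin.
      have := i0 (I c1) x; have := i0 (I c2) x; have := mulr_ge0 q0 (i0 J x).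
      by rewrite /g; lra.
    apply/seteqP; split=> // y; rewrite /xsection /= inE => /TP[].
    by rewrite leNgt x1.
  apply: (@le_trans _ _ q%:E).
    apply: le_trans (annulus_section x s1); apply: le_lebesgue_measure => y.
    by rewrite /xsection /= inE => /TP[_ _ []].
  have -> : g x = 2 * \1_(I c1) x + 2 * \1_(I c2) x + q.
    by rewrite /g [\1_J x]indicE mem_set ?mulr1// /J /= in_itv/= -ler_norml.
  by rewrite lee_fin; have := i0 (I c1) x; have := i0 (I c2) x; lra.
apply: (@le_trans _ _ (\int[lambda]_x (g x)%:E)%E).
  by apply: le_lower_integral => // x; exact: measure_ge0.
have mI c : measurable (I c) by exact: measurable_itv.
have mJ : measurable J by exact: measurable_itv.
have int_ind (k : R) (A : set R) : 0 <= k -> measurable A ->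
    (\int[lambda]_x (k * \1_A x)%:E = k%:E * lambda A)%E.
  move=> k0 mA.
  have -> : (\int[lambda]_x (k * \1_A x)%:E =
      \int[lambda]_x (k%:E * (\1_A x)%:E))%E by [].
  rewrite ge0_integralZl//; first by rewrite integral_indic// setIT.
  exact/measurable_EFinP/measurable_indic.
pose f (k : R) (A : set R) (x : R) := (k * \1_A x)%:E.
have nn (k : R) (A : set R) : 0 <= k -> forall x, setT x -> (0 <= f k A x)%E.
  by move=> k0 x _; rewrite lee_fin mulr_ge0.
have mf (k : R) (A : set R) : measurable A -> measurable_fun setT (f k A).
  by move=> mA; apply/measurable_EFinP; apply: measurable_funM.
have two0 : (0 : R) <= 2 by [].
have -> : (\int[lambda]_x (g x)%:E =
    \int[lambda]_x ((f 2%R (I c1) x + f 2%R (I c2) x) + f q J x))%E by [].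
rewrite ge0_integralD//; [|by move=> x _; rewrite adde_ge0 ?nn|
  by apply: emeasurable_funD; exact: mf|exact: nn|exact: mf].
rewrite ge0_integralD//; [|exact: nn|exact: mf|exact: nn|exact: mf].
rewrite !int_ind// !lI lJ -!EFinM -!EFinD lee_fin /q.
by lra.
Qed.

(* From a point off the strip, a vertical ray escapes to infinity. *)
Lemma hull_strip (T : set (R * R)) (S : set R) : closed S ->
  T `<=` [set w | S w.1 /\ `|w.2| <= 1] ->
  hull T `<=` [set w | S w.1 /\ `|w.2| <= 1].
Proof.
move=> cS; set K := [set w | _] => TK.
have cK : closed K.
  rewrite (_ : K = (fst @^-1` S) `&` (snd @^-1` `[-1, 1]%classic)).
    apply: closedI.
      by apply: preimage_closed => //; move=> ? ?; exact: cvg_fst.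
    apply: preimage_closed; first by move=> ? ?; exact: cvg_snd.
    exact: itv_closed.
  by apply/seteqP; split=> w; rewrite /K /= in_itv/= ler_norml.
have clK : closure T `<=` K by rewrite closureE; exact: smallest_sub.
move=> w [/clK//|[C [bC [q Aq CE]] Cw]]; apply: contrapT => nKw.
(* The ray goes up from above the strip and down from below it; at intermediate heights [w.1] lies
   outside [S], and the whole vertical line misses [K]. *)
have [e [e1 eK]] : exists e : R, `|e| = 1 /\
    forall t, 0 <= t -> ~ K (w.1, w.2 + e * t).
  have [w1|w1] := leP w.2 1; last first.
    exists 1; split=> [|t t0]; first exact: normr1.
    by move=> [_]; rewrite /= mul1r ler_norml; lra.
  have [w2|w2] := leP (-1) w.2; last first.
    exists (-1); split=> [|t t0]; first exact: normrN1.
    by move=> [_]; rewrite /= ler_norml; lra.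
  exists 1; split=> [|t t0 [/= Sw _]]; first exact: normr1.
  by apply: nKw; split=> //; rewrite ler_norml; lra.
pose L := (fun t : R => (w.1, w.2 + e * t)) @` `[0, +oo[%classic.
have Lw : L w.
  exists 0; first by rewrite /= in_itv/= lexx.
  by rewrite mulr0 addr0; case: (w).
have LA : L `<=` ~` closure T.
  move=> _ [t /= t0 <-] /clK; apply: eK.
  by move: t0; rewrite in_itv/= andbT.
have cL : connected L.
  apply: connected_continuous_connected.
    exact/connected_intervalP/interval_is_interval.
  apply: continuous_subspaceT.
  apply: (@lipschitz_le_continuous R R^o (R * R)%type _ 1) => z t.
  rewrite mul1r (_ : _ - _ = (0, e * (z - t)) :> R * R); last first.
    by apply: injective_projections => /=; ring.
  by rewrite [leLHS]/Num.Def.normr/= ge_max normr0 normr_ge0 normrM e1 mul1r lexx.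
have LC : L `<=` C.
  rewrite CE (same_connected_component (_ : connected_component _ q w)) -?CE//.
  exact: connected_component_max.
have [M [Mr /(_ (`|M| + 1))]] := bC.
have Mlt : M < `|M| + 1 by rewrite (le_lt_trans (ler_norm M))// ltrDl.
move=> /(_ Mlt) bnd.
pose t := `|M| + 2 + `|w.2|.
have t0 : 0 <= t by rewrite !addr_ge0.
have /LC/bnd : L (w.1, w.2 + e * t) by exists t => //=; rewrite in_itv/= t0.
rewrite /= leNgt => /negP; apply.
have : `|w.2 + e * t| <= `|(w.1, w.2 + e * t)|.
  by rewrite [leRHS]/Num.Def.normr/= le_max lexx orbT.
apply: lt_le_trans.
have := lerB_normD (e * t) w.2.
rewrite [e * t + _]addrC normrM e1 mul1r (ger0_norm t0).
by rewrite /t; lra.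
Qed.

End planar_measure.

(** * The sheared cutoff Hamiltonian *)

Section directional_calculus.
Context {R : realType} {n : nat}.
Implicit Types (f : 'M[R]_(n, 2) -> R) (z v : 'M[R]_(n, 2)).

Lemma is_derive_coord (i : 'I_n) (j : 'I_2) z v :
  is_derive z v (fun z => z i j) (v i j).
Proof.
apply: DeriveDef; last exact: derive_coord.
by apply: diff_derivable; exact: differentiable_coord.
Qed.

Lemma is_derive_bigsum (I : Type) (r : seq I) (P : pred I)
    (F : I -> 'M[R]_(n, 2) -> R) (d : I -> R) z v :
  (forall i, is_derive z v (F i) (d i)) ->
  is_derive z v (fun z => \sum_(i <- r | P i) F i z) (\sum_(i <- r | P i) d i).
Proof.
move=> Fd; elim: r => [|i r IH].
  rewrite big_nil (_ : (fun _ => _) = cst 0); first exact: is_derive_cst.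
  by apply/funext => w; rewrite big_nil.
rewrite big_cons; case: ifPn => Pi; last first.
  rewrite (_ : (fun _ => _) = (fun z => \sum_(i <- r | P i) F i z)) //.
  by apply/funext => w; rewrite big_cons (negbTE Pi).
rewrite (_ : (fun _ => _) = F i + (fun z => \sum_(i <- r | P i) F i z)).
  exact: is_deriveD.
by apply/funext => w; rewrite big_cons Pi.
Qed.

Lemma is_derive_dir_comp (h dh : R -> R) f z v (df : R) :
  differentiable f z -> is_derive z v f df ->
  (forall t : R, is_derive t 1 h (dh t)) ->
  is_derive z v (fun z => h (f z)) (dh (f z) * df).
Proof.
move=> fz [_ <-] hd; have [d e] := is_derive_comp_dir v fz hd.
by apply: DeriveDef => //; exact: diff_derivable.
Qed.

Definition sqsum (P : pred 'I_n) z : R := \sum_(i | P i) \sum_j z i j ^+ 2.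

Lemma Ck_sqsum k P : Ck k (sqsum P).
Proof.
apply: Ck_sum => i _; apply: Ck_sum => j _.
apply: (@eq_Ck _ _ _ _ (fun z => z i j * z i j)) => //.
by apply: CkM; exact: Ck_coord.
Qed.

Lemma is_derive_sqsum P z v :
  is_derive z v (sqsum P) (\sum_(i | P i) \sum_j 2 * z i j * v i j).
Proof.
apply: is_derive_bigsum => i; apply: is_derive_bigsum => j.
have d := is_derive_coord i j z v.
rewrite (_ : (fun _ => _) = (fun z => z i j) * (fun z => z i j)).
  by apply: is_derive_eq; rewrite /GRing.scale/=; ring.
by apply/funext => w; rewrite expr2.
Qed.

Lemma sum_delta (P : pred 'I_n) (G : 'I_n -> 'I_2 -> R) i j :
  \sum_(i' | P i') \sum_j' G i' j' * (delta_mx i j : 'M[R]_(n, 2)) i' j' =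
  if P i then G i j else 0.
Proof.
have z0 i' j' : (i' != i) || (j' != j) ->
    G i' j' * (delta_mx i j : 'M[R]_(n, 2)) i' j' = 0.
  by rewrite mxE -negb_and => /negbTE ->; rewrite mulr0.
case: ifPn => Pi.
  rewrite (bigD1 i)//= (bigD1 j)//= mxE !eqxx mulr1.
  rewrite big1 ?addr0 => [|j' jj]; last by rewrite z0// jj orbT.
  rewrite big1 ?addr0// => i' /andP[_ ii].
  by rewrite big1// => j' _; rewrite z0// ii.
rewrite big1// => i' Pi'; rewrite big1// => j' _; apply: z0.
by rewrite (_ : i' != i)//; apply: contraNneq Pi => <-.
Qed.

Lemma sqsum_ge_coord (P : pred 'I_n) z i j : P i -> z i j ^+ 2 <= sqsum P z.
Proof.
move=> Pi; rewrite /sqsum (bigD1 i)//= (bigD1 j)//= -addrA lerDl addr_ge0//.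
  by apply: sumr_ge0 => k _; exact: sqr_ge0.
by apply: sumr_ge0 => k _; apply: sumr_ge0 => l _; exact: sqr_ge0.
Qed.

End directional_calculus.

Section mx_box.
Context {R : realType} {m n : nat}.

Lemma mx_box_compact (C : R) :
  compact [set z : 'M[R]_(m, n) | forall i j, `|z i j| <= C].
Proof.
have cC : compact [set v : 'rV[R]_(m * n) | forall k, `[- C, C]%classic (v ord0 k)].
  apply: (@rV_compact R (m * n) (fun=> `[- C, C]%classic)) => k.
  exact: segment_compact.
have cv : continuous (fun v : 'rV[R]_(m * n) => vec_mx v : 'M[R]_(m, n)).
  apply: (@lipschitz_le_continuous R 'rV[R]_(m * n) 'M[R]_(m, n) _ 1) => v w.
  rewrite mul1r -linearB; apply/mx_norm_leP => // i j.
  by rewrite mxE; exact: mx_coord_le.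
suff -> : [set z : 'M[R]_(m, n) | forall i j, `|z i j| <= C] =
    (fun v : 'rV[R]_(m * n) => vec_mx v : 'M[R]_(m, n)) @`
    [set v : 'rV[R]_(m * n) | forall k, `[- C, C]%classic (v ord0 k)].
  by apply: continuous_compact => //; exact: continuous_subspaceT.
apply/seteqP; split=> [z zC|_ [v vC <-] i j].
  exists (mxvec z); last by rewrite mxvecK.
  by move=> k; case/mxvec_indexP: k => i j; rewrite mxvecE /= in_itv/= -ler_norml.
by rewrite mxE; have := vC (mxvec_index i j); rewrite /= in_itv/= -ler_norml.
Qed.

End mx_box.

Section sheared_cutoff_bounds.
Context {R : realType}.

Lemma normM_le (x y a b : R) : `|x| <= a -> `|y| <= b -> `|x * y| <= a * b.
Proof. by move=> xa yb; rewrite normrM ler_pM. Qed.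

Lemma norm_cutoff_le1 (a b t : R) : `|cutoff a b t| <= 1.
Proof. by rewrite ger0_norm ?cutoff_ge0 ?cutoff_le1. Qed.

Lemma norm_sin_le1 (t : R) : `|sin t| <= 1.
Proof. by rewrite ler_norml sin_geN1 sin_le1. Qed.

Lemma norm_cos_le1 (t : R) : `|cos t| <= 1.
Proof. by rewrite ler_norml cos_geN1 cos_le1. Qed.

End sheared_cutoff_bounds.

Section sheared_cutoff.
Context {R : realType} {m : nat}.
Variables (k e L Q : R).
Hypotheses (k0 : 0 < k) (Q1 : 1 <= Q) (e0 : 0 <= e) (L0 : 0 <= L).

Local Notation V := 'M[R]_(m.+2, 2).
Local Notation i1 := (lift ord0 ord0 : 'I_m.+2).
Local Notation inner := (@sqsum R m.+2 (pred1 ord0)).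
Local Notation outer := (@sqsum R m.+2 (predC1 ord0)).

Definition phase (z : V) : R := L * z i1 0 + z ord0 0.

(** The outer cutoff is applied to the squared norm rescaled by [Q]: its plateau is [outer z <= Q],
    while the bound on [dcutoff 1 4] is the same for every [Q]. *)
Definition shear_ham (z : V) : R :=
  e * (cutoff (1 - k) 1 (inner z) * cutoff 1 4 (Q^-1 * outer z) * sin (phase z)).

Let ck1 : 1 - k < 1. Proof. by rewrite gtrBl. Qed.
Let lt14 : 1 < 4 :> R. Proof. by lra. Qed.
Let Q0 : 0 < Q. Proof. exact: lt_le_trans Q1. Qed.

(** Converts [z i j ^+ 2 < 4 * Q] into a bound on the coordinate that is linear in [Q], which is
    what the factor [Q^-1] can absorb. *)
Let Q_sqr : 4 * Q <= (2 * Q) ^+ 2.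
Proof.
have : 0 <= Q * (Q - 1) by rewrite mulr_ge0 ?subr_ge0// ltW.
by lra.
Qed.

Lemma cball_row0 (z : V) : cball pi (row ord0 z) <-> inner z <= 1.
Proof.
rewrite /cball /eucl_norm /= divff ?gt_eqF ?pi_gt0// ler_sqrt// big_ord1.
by rewrite /sqsum big_pred1_eq; under eq_bigr do rewrite mxE.
Qed.

Lemma smooth_shear_ham : smooth shear_ham.
Proof.
move=> j; apply: CkM; first exact: Ck_cst.
apply: CkM.
  apply: CkM; first by apply: Ck_cutoff; exact: Ck_sqsum.
  by apply: Ck_cutoff; apply: CkM; [exact: Ck_cst|exact: Ck_sqsum].
apply: (@eq_Ck _ _ _ _ (fun z => sin (phase z + 0%:R * (pi / 2)))).
  by move=> z; rewrite mul0r addr0.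
apply: (@Ck_comp _ _ _ (fun j t => sin (t + j%:R * (pi / 2))) 0%N).
  move=> l t; apply: is_derive_eq.
  rewrite -[l.+1]addn1 natrD [_ * (pi / 2) in RHS]mulrDl mul1r addrA.
  by rewrite sinDpihalf addr0 mulr1.
by apply: CkD; [apply: CkM; [exact: Ck_cst|exact: Ck_coord]|exact: Ck_coord].
Qed.

Lemma derive_shear_ham (z v : V) : 'D_v shear_ham z = e * (
  dcutoff (1 - k) 1 (inner z) * (\sum_(i | pred1 ord0 i) \sum_j 2 * z i j * v i j)
    * cutoff 1 4 (Q^-1 * outer z) * sin (phase z) +
  cutoff (1 - k) 1 (inner z) * (dcutoff 1 4 (Q^-1 * outer z) *
    (Q^-1 * \sum_(i | predC1 ord0 i) \sum_j 2 * z i j * v i j)) * sin (phase z) +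
  cutoff (1 - k) 1 (inner z) * cutoff 1 4 (Q^-1 * outer z) *
    (cos (phase z) * (L * v i1 0 + v ord0 0))).
Proof.
have din : differentiable inner z by exact: Ck_differentiable (Ck_sqsum 1 _).
have dou : differentiable outer z by exact: Ck_differentiable (Ck_sqsum 1 _).
have Cph j : Ck j phase.
  by apply: CkD; [apply: CkM; [exact: Ck_cst|exact: Ck_coord]|exact: Ck_coord].
have dph : differentiable phase z by exact: Ck_differentiable (Cph 1%N).
have Cou : Ck 1 (fun z => Q^-1 * outer z).
  by apply: CkM; [exact: Ck_cst|exact: Ck_sqsum].
have dQou : is_derive z v (fun z => Q^-1 * outer z)
    (Q^-1 * \sum_(i | predC1 ord0 i) \sum_j 2 * z i j * v i j).
  exact: (is_deriveZ Q^-1 (is_derive_sqsum (predC1 ord0) z v)).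
have dphase : is_derive z v phase (L * v i1 0 + v ord0 0).
  exact: (is_deriveD (is_deriveZ L (is_derive_coord i1 0 z v))
    (is_derive_coord ord0 0 z v)).
have d1 := is_derive_dir_comp din (is_derive_sqsum (pred1 ord0) z v)
  (is_derive_cutoff (1 - k) 1).
have d2 := is_derive_dir_comp (Ck_differentiable z Cou) dQou (is_derive_cutoff 1 4).
have d3 := is_derive_dir_comp dph dphase (@is_derive_sin R).
have := is_deriveZ e (is_deriveM (is_deriveM d1 d2) d3) => -[_].
rewrite /shear_ham => E; apply: etrans E _.
rewrite /GRing.scale/=. by rewrite !fctE; ring.
Qed.

Lemma norm_shear_ham_le (z : V) : `|shear_ham z| <= e.
Proof.
apply: le_trans (normM_le (lexx `|e|) (normM_le
  (normM_le (norm_cutoff_le1 _ _ _) (norm_cutoff_le1 _ _ _)) (norm_sin_le1 _))) _.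
by rewrite !mulr1 ger0_norm.
Qed.

Lemma shear_ham_supp (z : V) : shear_ham z != 0 -> inner z < 1 /\ outer z < 4 * Q.
Proof.
move=> hz; split; rewrite ltNge; apply: contraNN hz => h; apply/eqP.
  by rewrite /shear_ham cutoff_eq0// !mul0r mulr0.
rewrite /shear_ham (cutoff_eq0 lt14) ?mulr0 ?mul0r ?mulr0//.
by rewrite mulrC ler_pdivlMr.
Qed.

Lemma sqsum_box (z : V) : inner z < 1 -> outer z < 4 * Q ->
  forall i j, `|z i j| <= 2 * Q.
Proof.
move=> h1 h2 i j.
have Q20 : 0 <= 2 * Q by rewrite mulr_ge0// ltW.
rewrite -(@ler_pXn2r _ 2)// ?nnegrE// real_normK ?num_real//.
have QQ : 4 * Q <= (2 * Q) ^+ 2 := Q_sqr.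
have [->|i0] := eqVneq i ord0.
  have := @sqsum_ge_coord _ _ (pred1 ord0) z ord0 j (eqxx _).
  by move: h1 Q1 QQ; lra.
by have := @sqsum_ge_coord _ _ (predC1 ord0) z i j i0; lra.
Qed.

Lemma Hc_shear_ham : Hc shear_ham.
Proof.
have box : compact (supp shear_ham).
  have cB := @mx_box_compact R m.+2 2 (2 * Q).
  apply: (subclosed_compact _ cB); first exact: closed_closure.
  rewrite /supp closureE; apply: smallest_sub.
    by apply: compact_closed => //; exact: norm_hausdorff.
  by move=> z /shear_ham_supp[h1 h2]; exact: sqsum_box.
split=> //; first exact: smooth_shear_ham.
rewrite /supp closureE; apply: smallest_sub.
  rewrite (_ : @cylinder R m.+1 = inner @^-1` [set x | x <= 1]).
    apply: preimage_closed; last exact: closed_le.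
    by move=> z _; exact: (Ck_sqsum 0).
  by apply/seteqP; split=> z /cball_row0.
by move=> z /shear_ham_supp[/ltW h1 _]; apply/cball_row0.
Qed.

(** The bound is free of [L], which multiplies a coordinate of the second row only. The cutoff
    contributes [2 * B], since its derivative vanishes outside the unit disc, and the phase
    contributes [1]. *)
Lemma derive_inner_bound (B : R) (z : V) j :
  (forall t, `|dcutoff (1 - k) 1 t| <= B) ->
  `|'D_(delta_mx ord0 j) shear_ham z| <= e * (2 * B + 1).
Proof.
move=> dB; rewrite derive_shear_ham !sum_delta/= !mxE !eqxx/= eq_sym.
rewrite !mulr0 mul0r addr0 add0r normrM (ger0_norm e0) ler_wpM2l//.
have B0 : 0 <= B := le_trans (normr_ge0 _) (dB 0).
apply: (le_trans (ler_normD _ _)); apply: lerD.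
  have [z1|z1] := leP 1 (inner z).
    by rewrite dcutoff_eq0r// !mul0r normr0 mulr_ge0.
  have zj : `|z ord0 j| <= 1.
    rewrite -(@ler_pXn2r _ 2)// ?nnegrE// real_normK ?num_real// expr1n.
    by apply: le_trans (ltW z1); apply: sqsum_ge_coord => /=.
  have z2 : `|2 * z ord0 j| <= 2 * 1 by apply: normM_le => //; rewrite ger0_norm.
  apply: le_trans (normM_le (normM_le (normM_le (dB _) z2)
    (norm_cutoff_le1 _ _ _)) (norm_sin_le1 _)) _.
  by lra.
have j1 : `|(j == 0)%:R : R| <= 1 by case: (_ == _); rewrite ?normr0 ?normr1.
apply: le_trans (normM_le (normM_le (norm_cutoff_le1 _ _ _)
  (norm_cutoff_le1 _ _ _)) (normM_le (norm_cos_le1 _) j1)) _.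
by rewrite !mulr1.
Qed.

(** The bound is free of [Q]: where the derivative of the outer cutoff is nonzero, [z i j] is at
    most [2 * Q] in absolute value, so the factor [Q^-1 * (2 * z i j)] is at most [4]. *)
Lemma derive_outer_bound (B : R) (z : V) i j : i != ord0 ->
  (forall t, `|dcutoff 1 4 t| <= B) ->
  `|'D_(delta_mx i j) shear_ham z| <= e * (4 * B + L).
Proof.
move=> i0 dB; rewrite derive_shear_ham !sum_delta/= (negbTE i0)/= !mxE.
rewrite [ord0 == i]eq_sym (negbTE i0)/= addr0.
rewrite !mulr0 !mul0r add0r normrM (ger0_norm e0) ler_wpM2l//.
have B0 : 0 <= B := le_trans (normr_ge0 _) (dB 0).
apply: (le_trans (ler_normD _ _)); apply: lerD.
  have [z1|z1] := leP 4 (Q^-1 * outer z).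
    by rewrite (dcutoff_eq0r lt14)// !(mul0r, mulr0) normr0 mulr_ge0.
  have zj : `|Q^-1 * (2 * z i j)| <= 4.
    suff h : `|z i j| <= 2 * Q.
      apply: le_trans (normM_le (lexx _) (normM_le (lexx _) h)) _.
      rewrite !ger0_norm ?invr_ge0 ?(ltW Q0)//.
      by rewrite (_ : Q^-1 * (2 * (2 * Q)) = 4)//; field; rewrite gt_eqF.
    rewrite -(@ler_pXn2r _ 2)// ?nnegrE ?mulr_ge0 ?ltW// real_normK ?num_real//.
    have := @sqsum_ge_coord _ _ (predC1 ord0) z i j i0.
    have : outer z < 4 * Q by move: z1; rewrite mulrC ltr_pdivrMr.
    by have := Q_sqr; lra.
  apply: le_trans (normM_le (normM_le (norm_cutoff_le1 _ _ _)
    (normM_le (dB _) zj)) (norm_sin_le1 _)) _.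
  by lra.
have j1 (b : bool) : `|b%:R : R| <= 1 by case: b; rewrite ?normr0 ?normr1.
apply: le_trans (normM_le (normM_le (norm_cutoff_le1 _ _ _)
  (norm_cutoff_le1 _ _ _)) (normM_le (norm_cos_le1 _)
  (normM_le (lexx `|L|) (j1 _)))) _.
by rewrite !mulr1 !mul1r ger0_norm.
Qed.

Lemma derive_plateau (z v : V) : inner z <= 1 - k -> outer z <= Q ->
  'D_v shear_ham z = e * (cos (phase z) * (L * v i1 0 + v ord0 0)).
Proof.
move=> h1 h2; have h2' : Q^-1 * outer z <= 1 by rewrite mulrC ler_pdivrMr// mul1r.
rewrite derive_shear_ham !cutoff_eq1// !dcutoff_eq0l//.
by rewrite !(mul0r, mulr0, add0r, mul1r).
Qed.

End sheared_cutoff.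

(** * Its flow *)

Section sheared_flow.
Context {R : realType} {m : nat}.
Variables (k e L Q B1 B2 : R).
Hypotheses (k0 : 0 < k) (Q1 : 1 <= Q) (e0 : 0 <= e) (L0 : 0 <= L).
Hypotheses (dB1 : forall t, `|dcutoff (1 - k) 1 t| <= B1)
  (dB2 : forall t, `|@dcutoff R 1 4 t| <= B2).
(** During unit time a coordinate of the first row drifts by at most [d], one of any other row by at
    most [s]. [Q_large] says that the [m.+1 * 2] coordinates outside the first row, each at most
    [1 + s], stay in the outer plateau. *)
Let d := e * (2 * B1 + 1).
Let s := e * (4 * B2 + L).
Hypotheses (d_small : 6 * d <= k) (k1 : k <= 1)
  (Q_large : (m.+1 * 2)%:R * (1 + s) ^+ 2 <= Q).

Local Notation V := 'M[R]_(m.+2, 2).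
Local Notation i1 := (lift ord0 ord0 : 'I_m.+2).
Local Notation inner := (@sqsum R m.+2 (pred1 ord0)).
Local Notation outer := (@sqsum R m.+2 (predC1 ord0)).
Local Notation H := (@shear_ham R m k e L Q).

Variable u : R -> V.
Hypothesis uH : forall t : R, is_derive t 1 u (ham_vf H (u t)).
Hypothesis u01 : forall i j, `|u 0 i j| <= 1.

Let coordH i j (t : R) := (is_derive_mxP u (fun t => ham_vf H (u t)) t).1 (uH t) i j.

Let B1_ge0 : 0 <= B1. Proof. exact: le_trans (normr_ge0 _) (dB1 0). Qed.
Let B2_ge0 : 0 <= B2. Proof. exact: le_trans (normr_ge0 _) (dB2 0). Qed.
Let d_ge0 : 0 <= d. Proof. by rewrite mulr_ge0// addr_ge0// mulr_ge0. Qed.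
Let s_ge0 : 0 <= s. Proof. by rewrite mulr_ge0// addr_ge0// mulr_ge0. Qed.

Let norm_ham_vf i j z c : (forall j, `|'D_(delta_mx i j) H z| <= c) ->
  `|ham_vf H z i j| <= c.
Proof. by move=> h; rewrite mxE; case: ifP => _; rewrite ?normrN. Qed.

Let coord_drift i j c t : 0 <= c -> 0 <= t <= 1 ->
  (forall z j, `|'D_(delta_mx i j) H z| <= c) -> `|u t i j - u 0 i j| <= c.
Proof.
move=> c0 /andP[t0 t1] h.
have := lipschitz_is_derive (coordH i j) (C := c).
move=> /(_ _ 0 t)/le_trans; apply=> [t'|]; first exact: norm_ham_vf.
by rewrite subr0 ger0_norm// ler_piMr.
Qed.

Let inner_drift j t : 0 <= t <= 1 -> `|u t ord0 j - u 0 ord0 j| <= d.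
Proof. by move=> t01; apply: coord_drift => // z l; exact: derive_inner_bound. Qed.

Let outer_drift i j t : i != ord0 -> 0 <= t <= 1 -> `|u t i j - u 0 i j| <= s.
Proof. by move=> i0 t01; apply: coord_drift => // z l; exact: derive_outer_bound. Qed.

Let innerE (z : V) : inner z = z ord0 0 ^+ 2 + z ord0 1 ^+ 2.
Proof. by rewrite /sqsum big_pred1_eq sum_ord2. Qed.

Let sqr_drift (x y c : R) : `|x| <= 1 -> `|y - x| <= c ->
  x ^+ 2 - 2 * c <= y ^+ 2 <= x ^+ 2 + 2 * c + c ^+ 2.
Proof.
move=> x1 yx.
have c0 : 0 <= c := le_trans (normr_ge0 _) yx.
have yE : y ^+ 2 = x ^+ 2 + 2 * (x * (y - x)) + (y - x) ^+ 2 by ring.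
have := normM_le x1 yx; rewrite mul1r ler_norml => /andP[h1 h2].
have h3 : 0 <= (y - x) ^+ 2 := sqr_ge0 _.
have h4 : (y - x) ^+ 2 <= c ^+ 2.
  by rewrite -(real_normK (num_real (y - x))) ler_pXn2r// nnegrE.
by rewrite yE; lra.
Qed.

(** Each of the two squares loses at most [2 * d], and [4 * d <= k]. The drift bound holds inside
    and outside the plateau alike, so it also covers orbits crossing the region where the cutoff
    varies. *)
Lemma inner_flow_ge : 1 - 2 * k <= inner (u 0) -> 1 - 3 * k <= inner (u 1).
Proof.
have h j (t01 : 0 <= 1 <= (1 : R)) := sqr_drift (u01 ord0 j) (@inner_drift j 1 t01).
have := h 0; have := h 1; rewrite !innerE ler01 lexx.
move=> /(_ isT)/andP[+ _] /(_ isT)/andP[+ _]; move: d_small d_ge0.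
by lra.
Qed.

(** * Orbits that stay where both cutoffs equal one *)

Section plateau.
Hypothesis u0_in : inner (u 0) <= 1 - 2 * k.

(** Each square gains at most [2 * d + d ^+ 2 <= 3 * d], and [6 * d <= k]. As the drift bounds hold
    on the whole space, they confine the orbit directly, with no continuation argument in time. *)
Let flow_in t : 0 <= t <= 1 -> inner (u t) <= 1 - k.
Proof.
move=> t01; have h j := sqr_drift (u01 ord0 j) (@inner_drift j t t01).
have := h 0; have := h 1; move: u0_in; rewrite !innerE => hu.
move=> /andP[_ h1] /andP[_ h2]; have d1 : d ^+ 2 <= d.
  by rewrite expr2 ler_piMr//; move: d_small k1 d_ge0; lra.
by move: d_small; lra.
Qed.

Let flow_out t : 0 <= t <= 1 -> outer (u t) <= Q.
Proof.
move=> t01; apply: le_trans Q_large.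
have -> : (m.+1 * 2)%:R * (1 + s) ^+ 2 =
    \sum_(i | predC1 (ord0 : 'I_m.+2) i) \sum_(j < 2) (1 + s) ^+ 2.
  rewrite sumr_const cardC1 card_ord sumr_const card_ord -mulrnA.
  by rewrite mulr_natl mulnC.
apply: ler_sum => i i0; apply: ler_sum => j _.
rewrite -(real_normK (num_real (u t i j))) ler_pXn2r// ?nnegrE ?addr_ge0//.
rewrite -[u t i j](subrK (u 0 i j)) addrC (le_trans (ler_normD _ _))//.
by rewrite lerD// outer_drift.
Qed.

(** On the plateau the Hamiltonian depends on the [x] coordinates alone, and the speed of [x_i] is
    its derivative in [y_i]. *)
Lemma flow_x_const i t : 0 <= t <= 1 -> u t i 0 = u 0 i 0.
Proof.
move=> /andP[t0 t1]; apply/eqP; rewrite -subr_eq0 -normr_le0 -[leRHS](subrr (0 : R)).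
apply: (@is_derive_norm_le _ _ _ (cst 0) (cst 0) 0 t t0 (coordH i 0)) => // r.
move=> /andP[r0 rt].
have r01 : 0 <= r <= 1 by rewrite r0 (le_trans rt).
rewrite mxE/= derive_plateau//; [|exact: flow_in|exact: flow_out].
by rewrite !mxE !andbF mulr0 addr0 !mulr0 normr0.
Qed.

(** The phase is constant along the orbit, so [y_2] moves at constant speed. The cosine is written
    at the end point because a slice prescribes [x_2] and [y_2] there. *)
Lemma flow_y_shear : u 1 i1 1 = u 0 i1 1 - e * L * cos (phase L (u 1)).
Proof.
pose c := e * L * cos (phase L (u 0)).
have cE : cos (phase L (u 1)) = cos (phase L (u 0)).
  by rewrite /phase !flow_x_const// ler01 lexx.
have le01 : 0 <= 1 :> R by [].
have dc (t : R) : is_derive t 1 (fun t => u t i1 1 + c * t)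
    (ham_vf H (u t) i1 1 + c).
  have := coordH i1 1 t => h; apply: is_derive_eq; rewrite /GRing.scale/=.
  by rewrite mulr1.
have : `|(u 1 i1 1 + c * 1) - (u 0 i1 1 + c * 0)| <= 0.
  rewrite -[leRHS](subrr (0 : R)).
  apply: (@is_derive_norm_le _ _ _ (cst 0) (cst 0) 0 1 le01 dc) => // t t01.
  rewrite mxE/= derive_plateau//; [|exact: flow_in|exact: flow_out].
  rewrite /c !mxE/= ?eqxx/= mulr1 addr0 /phase !flow_x_const//.
  by rewrite (_ : - _ + _ = 0) ?normr0//; ring.
rewrite mulr0 mulr1 addr0 normr_le0 cE -/c => /eqP.
by lra.
Qed.

End plateau.
End sheared_flow.

(** * Slices of the image of the ball *)

Section slices.
Context {R : realType} {m : nat}.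
Local Notation V := 'M[R]_(m.+2, 2).
Local Notation inner := (@sqsum R m.+2 (pred1 ord0)).

Lemma cball_sqsum (a : R) (z : V) : 0 <= a -> cball a z -> sqsum predT z <= a / pi.
Proof.
by move=> a0; rewrite /cball /eucl_norm /= ler_sqrt// divr_ge0// pi_ge0.
Qed.

Lemma inner_le_sqsum (z : V) : inner z <= sqsum predT z.
Proof.
rewrite /sqsum [leRHS](bigID (pred1 ord0))/= lerDl.
by apply: sumr_ge0 => i _; apply: sumr_ge0 => j _; exact: sqr_ge0.
Qed.

Lemma norm_le1_sqsum (P : pred 'I_m.+2) (z : V) i j :
  P i -> sqsum P z <= 1 -> `|z i j| <= 1.
Proof.
move=> Pi z1; rewrite -(@ler_pXn2r _ 2)// ?nnegrE// real_normK ?num_real// expr1n.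
exact: le_trans (sqsum_ge_coord z j Pi) z1.
Qed.

Lemma norm_le1_inner (z : V) j : inner z <= 1 -> `|z ord0 j| <= 1.
Proof. by move=> z1; apply: norm_le1_sqsum z1 => /=. Qed.

Lemma shear_deformation (k eta : R) : 0 < k <= 1 -> 0 < eta ->
  exists (H : V -> R) (phi : V -> V),
  [/\ Hc H, is_time1_map H phi, forall z, `|H z| <= eta &
   forall x : 'M[R]_(m.+1, 2), exists c1 c2, forall z, cball pi z ->
     disc x (phi z) ->
     (inner z <= 1 - 2 * k /\
       (`|phi z ord0 0 - c1| <= eta \/ `|phi z ord0 0 - c2| <= eta)) \/
     (1 - 2 * k < inner z /\ 1 - 3 * k <= inner (phi z))].
Proof.
move=> /andP[k0 k1] eta0.
have [B1 B10 dB1] := dcutoff_bounded (1 - k) 1.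
have [B2 B20 dB2] := @dcutoff_bounded R 1 4.
have B0 : 0 < 6 * (2 * B1 + 1) by rewrite mulr_gt0// ltr_wpDl// mulr_ge0.
(* The first entry keeps the Hamiltonian below [eta], the second gives [6 * d <= k] for the drift
   [d] of the first row. *)
pose e := Num.min eta (k / (6 * (2 * B1 + 1))).
have e0 : 0 < e by rewrite lt_min eta0 divr_gt0.
(* Chosen so that [cos_band_intervals], used with [eta / 8] for its [e], yields intervals of
   half-width exactly [eta]. *)
pose A := (eta / 8) ^- 2.
have eta8 : 0 < eta / 8 by rewrite divr_gt0.
have A0 : 0 < A by rewrite invr_gt0 exprn_gt0.
pose L := A / e.
have L0 : 0 <= L by rewrite divr_ge0// ltW.
have eL : e * L = A by rewrite /L; field; rewrite gt_eqF.
pose s := e * (4 * B2 + L).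
have s0 : 0 <= s by rewrite mulr_ge0 ?(ltW e0)// addr_ge0// mulr_ge0.
pose Q := (m.+1 * 2)%:R * (1 + s) ^+ 2.
have Q1 : 1 <= Q.
  have h : 1 <= (1 + s) ^+ 2 by rewrite exprn_ege1// lerDl.
  by apply: (le_trans h); rewrite ler_peMl ?ler1n//; exact: le_trans h.
have d_small : 6 * (e * (2 * B1 + 1)) <= k.
  by rewrite mulrCA -ler_pdivlMr// ge_min lexx orbT.
pose H := @shear_ham R m k e L Q.
have [sH cH _] : Hc H by exact: Hc_shear_ham.
have [Phi PhiP] := ham_flow_exists sH cH.
exists H, (Phi 1); split.
- exact: Hc_shear_ham.
- exists (ham_vf H), Phi; split=> //; apply: ham_vfP => z.
  exact: smooth_differentiable sH.
- move=> z; apply: (le_trans (norm_shear_ham_le k L Q (ltW e0) z)).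
  by rewrite ge_min lexx.
move=> x.
have [c1 [c2 cP]] := cos_band_intervals (L * x ord0 0) (x ord0 1) eta8
  (mulVf (lt0r_neq0 (exprn_gt0 2 eta8))).
exists c1, c2 => z /(cball_sqsum (pi_ge0 R)); rewrite divff ?gt_eqF ?pi_gt0// => z1.
move=> [/cball_row0 w1 wx].
have [P0 uH] := PhiP z.
have u01 i j : `|Phi 0 z i j| <= 1 by rewrite P0; exact: norm_le1_sqsum z1.
have [zin|zin] := leP (inner z) (1 - 2 * k).
  left; split=> //.
  have zin' : inner (Phi 0 z) <= 1 - 2 * k by rewrite P0.
  have := flow_y_shear k0 Q1 (ltW e0) L0 dB1 dB2 d_small k1 (lexx Q) uH u01 zin'.
  have xE j : x ord0 j = Phi 1 z (lift ord0 ord0) j by rewrite -wx mxE.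
  rewrite /phase -!xE eL => yE.
  have := cP (Phi 1 z ord0 0); rewrite (_ : 8 * (eta / 8) = eta); last by field.
  apply; first exact: norm_le1_inner.
  (* The constrained quantity [y_2 + A * cos (phase)] at the end point is the initial [y_2], at most
     [1] in absolute value because [z] lies in the unit ball. *)
  by rewrite yE subrK.
right; split=> //.
have zin' : 1 - 2 * k <= inner (Phi 0 z) by rewrite P0 ltW.
exact: (inner_flow_ge k0 (ltW e0) dB1 d_small uH u01 zin').
Qed.

Lemma osc_le (H : V -> R) (c : R) : (forall z, `|H z| <= c) ->
  (osc H <= (2 * c)%:E)%E.
Proof.
move=> Hc; rewrite (_ : 2 * c = c - (- c)); last by ring.
rewrite EFinB /osc; apply: leeB.
  apply: ge_ereal_sup => _ [z _ <-]; rewrite lee_fin.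
  exact: le_trans (ler_norm _) (Hc z).
apply: le_ereal_inf_tmp => _ [z _ <-]; rewrite lee_fin.
by have := Hc z; rewrite ler_norml => /andP[].
Qed.

Lemma osc_ge0 (H : V -> R) : (0 <= osc H)%E.
Proof.
rewrite -(subee (_ : (H 0)%:E \is a fin_num))// /osc; apply: leeB.
  by apply: ereal_sup_ubound; exists 0.
by apply: ereal_inf_lbound; exists 0.
Qed.

Lemma mu_ge0 (T : set (R * R)) : (0 <= mu T)%E.
Proof. by apply: integral_ge0 => x _; exact: measure_ge0. Qed.

Lemma sigma_ge0 (nu : set (R * R) -> \bar R) (a : R) :
  (forall T, 0 <= nu T)%E -> (0 <= sigma_of nu m.+2 a)%E.
Proof.
move=> nu0; apply: le_ereal_inf_tmp => _ [H [phi [_ _ ->]]].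
apply: adde_ge0; last exact: osc_ge0.
apply: (le_trans (nu0 (proj1 @` (phi @` (@cball R m.+2 a) `&` disc 0)))).
by apply: ereal_sup_ubound; exists 0.
Qed.

Lemma sigma_le (nu : set (R * R) -> \bar R) (a c1 c2 : R)
    (H : V -> R) (phi : V -> V) :
  Hc H -> is_time1_map H phi -> (forall z, `|H z| <= c1) ->
  (forall x : 'M[R]_(m.+1, 2),
    nu (proj1 @` (phi @` (@cball R m.+2 a) `&` disc x)) <= c2%:E)%E ->
  (sigma_of nu m.+2 a <= (c2 + 2 * c1)%:E)%E.
Proof.
move=> hH hphi Hc1 nuc2.
apply: (@le_trans _ _ (slice_sup nu a phi + osc H)%E).
  by apply: ereal_inf_lbound; exists H, phi.
rewrite EFinD; apply: leeD; last exact: osc_le.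
by apply: ge_ereal_sup => _ [x _ <-]; exact: nuc2.
Qed.

Lemma sigmaH_eq0 (a : R) : 0 < a <= pi -> sigmaH m.+2 a = 0%E.
Proof.
move=> /andP[a0 api]; apply/eqP; rewrite eq_le sigma_ge0 ?andbT; last exact: mu_ge0.
apply/lee_addgt0Pr => eta eta0; rewrite add0e.
(* This makes [sqrt (3 * k) <= eta / 8]. Strips, annulus and oscillation then contribute [8 / 20],
   [1 / 2] and [2 / 20] of [eta], which add up to [eta]. *)
pose k := Num.min 1 ((eta / 8) ^+ 2 / 3).
have k0 : 0 < k by rewrite lt_min ltr01 divr_gt0// exprn_gt0// divr_gt0.
have k01 : 0 < k <= 1 by rewrite k0 ge_min lexx.
have r0 : 0 < eta / 20 by rewrite divr_gt0.
have [H [phi [hH hphi Hle sl]]] := shear_deformation k01 r0.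
apply: (@le_trans _ _
    ((8 * (eta / 20) + 4 * Num.sqrt (1 - (1 - 3 * k))) + 2 * (eta / 20))%:E).
  apply: (sigma_le hH hphi Hle) => x; have [c1 [c2 cP]] := sl x.
  apply: (@mu_strips_annulus _ _ c1 c2); [exact: ltW|by lra|].
  move=> X Y [w [[z za <-] dw] [<- <-]].
  have zpi : cball pi z.
    apply: (le_trans za); rewrite ler_wsqrtr// ler_wpM2r// invr_ge0.
    exact: pi_ge0.
  have /cball_row0 w1 := dw.1.
  split; [exact: norm_le1_inner..|].
  have [[_ [h|h]]|[_ h]] := cP z zpi dw; [exact: Or31|exact: Or32|apply: Or33].
  move: h w1; rewrite /sqsum big_pred1_eq sum_ord2 => h w1.
  by rewrite h w1.
rewrite lee_fin.
have : Num.sqrt (1 - (1 - 3 * k)) <= eta / 8.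
  rewrite -[leRHS]ger0_norm; last by rewrite divr_ge0// ltW.
  rewrite -sqrtr_sqr ler_wsqrtr//.
  have : k <= (eta / 8) ^+ 2 / 3 by rewrite ge_min lexx orbT.
  by lra.
by lra.
Qed.

Lemma sigmaH_hat_eq0 (a : R) : 0 < a < pi -> sigmaH_hat m.+2 a = 0%E.
Proof.
move=> /andP[a0 api]; apply/eqP; rewrite eq_le sigma_ge0 ?andbT; last first.
  by move=> T; exact: mu_ge0.
apply/lee_addgt0Pr => eta eta0; rewrite add0e.
have p0 := pi_gt0 R.
have api0 : 0 < a / pi by rewrite divr_gt0.
have api1 : a / pi < 1 by rewrite ltr_pdivrMr// mul1r.
(* Now [1 - 2 * k = a / pi], so no point of the ball satisfies [1 - 2 * k < inner z] and the annulus
   alternative is void; the area bound is later used with [s = 1]. *)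
pose k := (1 - a / pi) / 2.
have k01 : 0 < k <= 1 by rewrite /k; lra.
have r0 : 0 < eta / 20 by rewrite divr_gt0.
have [H [phi [hH hphi Hle sl]]] := shear_deformation k01 r0.
apply: (@le_trans _ _
    ((8 * (eta / 20) + 4 * Num.sqrt (1 - 1)) + 2 * (eta / 20))%:E); last first.
  by rewrite lee_fin subrr sqrtr0; lra.
apply: (sigma_le hH hphi Hle) => x; have [c1 [c2 cP]] := sl x.
pose I c := `[c - eta / 20, c + eta / 20]%classic : set R.
pose S := (I c1 `|` I c2) `&` `[-1, 1]%classic.
have inI (c X : R) : I c X <-> `|X - c| <= eta / 20.
  by rewrite /I /= in_itv/= ler_distl.
have cS : closed S.
  by apply: closedI; [apply: closedU|]; exact: itv_closed.
have TS : proj1 @` (phi @` (@cball R m.+2 a) `&` disc x) `<=`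
    [set w | S w.1 /\ `|w.2| <= 1].
  move=> _ [w [[z za <-] dw] <-] /=.
  have zpi : cball pi z.
    apply: (le_trans za); rewrite ler_wsqrtr// ler_wpM2r ?invr_ge0 ?pi_ge0//.
    exact: ltW.
  have /cball_row0 w1 := dw.1.
  have nw j : `|phi z ord0 j| <= 1 := norm_le1_inner j w1.
  have := cball_sqsum (ltW a0) za; have := inner_le_sqsum z => h1 h2.
  split=> //; split; last by rewrite /= in_itv/= -ler_norml.
  have [[_ [h|h]]|[h _]] := cP z zpi dw.
  - by left; apply/inI.
  - by right; apply/inI.
  - by move: h; rewrite /k; lra.
apply: (@mu_strips_annulus _ _ c1 c2); [exact: ltW|by []|].
move=> X Y /(hull_strip cS TS)[/= [SX X1] Y1].
split=> //; first by move: X1; rewrite /= in_itv/= -ler_norml.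
by case: SX => /inI h; [exact: Or31|exact: Or32].
Qed.

End slices.

Theorem theorem1p2 (R : realType) (n : nat) (hn : (2 <= n)%N) :
  (forall a : R, 0 < a <= pi -> sigmaH n a = 0%E) /\
  (forall a : R, 0 < a < pi -> sigmaH_hat n a = 0%E).
Proof.
by case: n hn => [|[|m]]// _; split=> a; [exact: sigmaH_eq0|exact: sigmaH_hat_eq0].
Qed.
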